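(* Let $r$ be the maximum arity among the relation symbols of $\sigma$ and let $k\ge r$. Then for every pair of $\sigma$-structures $\mathbf{A}$, $\mathbf{B}$ the following are equivalent: (1) $\mathbf{A}\equiv_k\mathbf{B}$; (2) $\hom(\mathbf{X};\mathbf{A})=\hom(\mathbf{X};\mathbf{B})$ for every $\sigma$-structure $\mathbf{X}$ of treewidth less than $k$; (3) $\mathbf{A}$ and $\mathbf{B}$ satisfy the same formulae of the logic $\mathscr{C}^k$.
   Context: A signature $\sigma$ is a finite set of relation symbols with arities $\operatorname{ar}(R)\ge1$; a $\sigma$-structure has finite universe and relations $R^\mathbf{A}\subseteq A^{\operatorname{ar}(R)}$. $\hom(\mathbf{X};\mathbf{A})$ is the number of homomorphisms from $\mathbf{X}$ to $\mathbf{A}$ (maps preserving all relations componentwise). Constraints: $\mathcal{C}_\mathbf{A}=\{R(\mathbf{a}):R\in\sigma,\mathbf{a}\in R^\mathbf{A}\}$. For a tuple $\mathbf{a}$, $a_i$ is its $i$-th entry, $\{\mathbf{a}\}$ its entry set, $\pi_\mathbf{i}\mathbf{a}=(a_{i_1},\dots,a_{i_n})$ for $\mathbf{i}=(i_1,\dots,i_n)$. A tree decomposition of $\mathbf{X}$ is a tree $G=(V,E)$ with $\beta:V\to\mathcal{P}(X)$ such that every $R(\mathbf{x})\in\mathcal{C}_\mathbf{X}$ has $\{\mathbf{x}\}\subseteq\beta(v)$ for some $v$, and for each $x$ the set of nodes $v$ with $x\in\beta(v)$ is connected in $G$; its width is $\max_v|\beta(v)|-1$; the treewidth of $\mathbf{X}$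 is the minimum width of its tree decompositions. $\mathscr{C}^k$ is the fragment of first-order logic over $\sigma$ enriched with counting quantifiers $\exists^{n}x$ (''there exist at least $n$ elements $x$ such that'') using at most $k$ distinct variables. $\equiv_1$: factor graph of $\mathbf{A}$ is the bipartite graph on $A\cup\mathcal{C}_\mathbf{A}$ with edges $\{a,R(\mathbf{a})\}$ for $a\in\{\mathbf{a}\}$ labelled $(\{i:a_i=a\},R)$; $\delta_0^\mathbf{A}(v)$ is one of two fixed symbols according as $v\in A$ or $v\in\mathcal{C}_\mathbf{A}$; $\delta_j^\mathbf{A}(v)=\{\{(\text{label of }\{v,w\},\delta_{j-1}^\mathbf{A}(w)):w\text{ adjacent to }v\}\}$; $\mathbf{A}\equiv_1\mathbf{B}$ iff the multisets of sequences $(\delta^\cdot_j(v))_{j\ge0}$ over all factor-graph vertices coincide. $\mathbf{A}^{*k}$: universe $\bigcup_{1\le j\le k}A^j\cup\mathcal{C}_\mathbf{A}$, unary relations $T_{j,S}=\{\mathbf{a}\in A^j:a_i=a_{i'}\ \forall i,i'\in S\}$ ($j\le k$, $S\subseteq[j]$), $R_S=\{R(\mathbf{a}):\mathbf{a}\in R^\mathbf{A},a_i=a_{i'}\ \forall i,i'\in S\}$ ($R\in\sigma$, $S\subseteq[\operatorname{ar}(R)]$), binary relations $T_{j,\mathbf{i}}=\{(\mathbf{a},\pi_\mathbf{i}\mathbf{a}):\mathbf{a}\in A^j\}$ ($j,j'\le k$, $\mathbf{i}\in[j]^{j'}$), $R_\mathbf{i}=\{(R(\mathbf{a}),\pi_\mathbf{i}\mathbf{a}):\mathbf{a}\in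 R^\mathbf{A}\}$ ($R\in\sigma$, $j\le k$, $\mathbf{i}\in[\operatorname{ar}(R)]^j$). For $k\ge2$, $\mathbf{A}\equiv_k\mathbf{B}$ means $\mathbf{A}^{*k}\equiv_1\mathbf{B}^{*k}$; for $k=1$ it is $\equiv_1$. *)

(* Defs.v *)
From HB Require Import structures.
From mathcomp Require Import all_boot all_order all_algebra.
From mathcomp Require Import finmap multiset.

Set Implicit Arguments.
Unset Strict Implicit.
Unset Printing Implicit Defensive.

Import GRing.Theory Num.Theory.

(* A signature: a finite set of relation symbols with arities.
   (Arities >= 1 are imposed as a hypothesis of the main theorem.) *)
Record sign := Sign { sym :> finType; ar : sym -> nat }.

Record struct (s : sign) := Struct {
  univ :> finType;
  rrel : forall R : s, {set (ar R).-tuple univ} }.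
Arguments rrel {s} _ _.

Definition maxar (s : sign) : nat := \max_(R : s) @ar s R.

Definition is_hom (s : sign) (X A : struct s) (f : X -> A) : bool :=
  [forall R : s, forall t in rrel X R, map_tuple f t \in rrel A R].

Definition homcount (s : sign) (X A : struct s) : nat :=
  #|[set f : {ffun X -> A} | is_hom f]|.

Definition is_tree (n : nat) (E : rel 'I_n) : Prop :=
  [/\ 0 < n, symmetric E, irreflexive E,
      (forall u v, connect E u v) &
      ~ (exists (x : 'I_n) (p : seq 'I_n),
            [/\ 2 <= size p, uniq (x :: p), path E x p & E (last x p) x])].

Definition tree_decomp (s : sign) (X : struct s) (n : nat)
    (E : rel 'I_n) (b : 'I_n -> {set X}) : Prop :=
  [/\ is_tree E,
      (forall (R : s) (t : (ar R).-tuple X), t \in rrel X R ->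
          exists v, [set x in t] \subset b v) &
      (forall (x : X) (u v : 'I_n), x \in b u -> x \in b v ->
          connect (fun p q => [&& E p q, x \in b p & x \in b q]) u v)].

(* width = max_v |b(v)| - 1  (an integer; -1 if all bags are empty) *)
Definition width (s : sign) (X : struct s) (n : nat) (b : 'I_n -> {set X}) : int :=
  ((\max_(v < n) #|b v|)%:Z - 1)%R.

Definition treewidth_lt (s : sign) (X : struct s) (k : nat) : Prop :=
  exists (n : nat) (E : rel 'I_n) (b : 'I_n -> {set X}),
    tree_decomp E b /\ (width b < k%:Z)%R.

Section FactorGraph.
Variable s : sign.

(* candidate constraints R(a) *)
Definition cons (A : struct s) := {R : s & (ar R).-tuple A}.
Definition isC (A : struct s) (c : cons A) : bool := tagged c \in rrel A (tag c).

(* edge labels (set of positions, relation symbol) *)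
Definition lab := {R : s & {set 'I_(ar R)}}.
Definition label (A : struct s) (a : A) (c : cons A) : lab :=
  Tagged (fun R => {set 'I_(ar R)}) [set i | tnth (tagged c) i == a].

Definition FV (A : struct s) := (A + cons A)%type.
Definition isV (A : struct s) (v : FV A) : bool :=
  if v is inr c then isC c else true.
Definition Vert (A : struct s) := {v : FV A | isV v}.

Fixpoint colT (j : nat) : choiceType :=
  if j is j'.+1 then (multiset (lab * colT j')%type : choiceType) else bool.

Fixpoint delta (A : struct s) (j : nat) : FV A -> colT j :=
  match j return FV A -> colT j with
  | 0 => fun v => if v is inl _ then true else false
  | j'.+1 => fun v =>
      match v with
      | inl a => seq_mset [seq (label a c, delta j' (inr c))
                          | c <- enum {: cons A} & isC c && (a \in tagged c)]
      | inr c => seq_mset [seq (label a c, delta j' (inl a))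
                          | a <- enum {: A} & a \in tagged c]
      end
  end.

(* A ≡_1 B: the multisets of colour sequences (delta_j(v))_j over all
   factor-graph vertices coincide, i.e. there is a bijection between the
   vertex sets preserving every delta_j. *)
Definition equiv1 (A B : struct s) : Prop :=
  exists f : Vert A -> Vert B,
    bijective f /\ forall (j : nat) (v : Vert A), delta j (val (f v)) = delta j (val v).

End FactorGraph.

Section Star.
Variables (s : sign) (k : nat).

(* Relation symbols of sigma^{*k}.  A length j in {1..k} is encoded as
   j.+1 with j : 'I_k.
   - T_{j,S}  (unary):   j in {1..k}, S ⊆ [j]
   - R_S      (unary):   R in sigma, S ⊆ [ar R]
   - T_{j,i}  (binary):  j, j' in {1..k}, i in [j]^{j'}   (jj = (j, j'))
   - R_i      (binary):  R in sigma, j in {1..k}, i in [ar R]^j        *)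
Definition symT1 := {j : 'I_k & {set 'I_j.+1}}.
Definition symR1 := {R : s & {set 'I_(ar R)}}.
Definition symT2 := {jj : 'I_k * 'I_k & (jj.2.+1).-tuple 'I_(jj.1.+1)}.
Definition symR2 := {R : s & {j : 'I_k & (j.+1).-tuple 'I_(ar R)}}.
Definition starsym : finType := (((symT1 + symR1) + symT2) + symR2)%type.
Definition star_ar (x : starsym) : nat :=
  match x with
  | inl (inl (inl _)) => 1
  | inl (inl (inr _)) => 1
  | _ => 2
  end.
Definition starsig : sign := Sign star_ar.

Variable A : struct s.

Definition SU0 := ({j : 'I_k & (j.+1).-tuple A} + cons A)%type.
Definition isSU (x : SU0) : bool := if x is inr c then isC c else true.
Definition SU : finType := {x : SU0 | isSU x}.

Definition urel (P : SU -> bool) : {set 1.-tuple SU} := [set u | P (thead u)].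
Definition brel (Q : SU -> SU -> bool) : {set 2.-tuple SU} :=
  [set u | Q (tnth u ord0) (tnth u ord_max)].

Definition PT (j : 'I_k) (S : {set 'I_j.+1}) (x : SU) : bool :=
  match val x with
  | inl t => (tag t == j) &&
             [forall i in S, forall i' in S, onth (tagged t) i == onth (tagged t) i']
  | inr _ => false
  end.

Definition PR (R : s) (S : {set 'I_(ar R)}) (x : SU) : bool :=
  match val x with
  | inr c => (tag c == R) &&
             [forall i in S, forall i' in S, onth (tagged c) i == onth (tagged c) i']
  | inl _ => false
  end.

Definition QT (j j' : 'I_k) (i : (j'.+1).-tuple 'I_j.+1) (x y : SU) : bool :=
  match val x, val y with
  | inl t, inl u => (tag t == j) &&
       (map Some (tagged u) == [seq onth (tagged t) n | n <- map val i])
  | _, _ => false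
  end.

Definition QR (R : s) (j : 'I_k) (i : (j.+1).-tuple 'I_(ar R)) (x y : SU) : bool :=
  match val x, val y with
  | inr c, inl u => (tag c == R) &&
       (map Some (tagged u) == [seq onth (tagged c) n | n <- map val i])
  | _, _ => false
  end.

Definition star_rel (x : starsig) : {set (ar x).-tuple SU} :=
  match x as x0 return {set (star_ar x0).-tuple SU} with
  | inl (inl (inl p)) => urel (PT (tagged p))
  | inl (inl (inr p)) => urel (PR (tagged p))
  | inl (inr p) => brel (QT (tagged p))
  | inr p => brel (QR (tagged (tagged p)))
  end.

Definition star : struct starsig := Struct star_rel.

End Star.

Definition equivk (s : sign) (k : nat) (A B : struct s) : Prop :=
  if k <= 1 then equiv1 A B else equiv1 (star k A) (star k B).

Inductive form (s : sign) (k : nat) : Type :=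
| FRel (R : s) (t : (ar R).-tuple 'I_k)
| FEq (x y : 'I_k)
| FNot (f : form s k)
| FAnd (f g : form s k)
| FExists (n : nat) (x : 'I_k) (f : form s k).

Fixpoint free (s : sign) (k : nat) (f : form s k) : {set 'I_k} :=
  match f with
  | FRel R t => [set x in t]
  | FEq x y => [set x; y]
  | FNot g => free g
  | FAnd g h => free g :|: free h
  | FExists _ x g => free g :\ x
  end.

Definition sentence (s : sign) (k : nat) (f : form s k) : bool := free f == set0.

Fixpoint sat (s : sign) (k : nat) (A : struct s) (al : 'I_k -> option A)
    (f : form s k) : bool :=
  match f with
  | FRel R t => [exists u : (ar R).-tuple A,
                   (u \in rrel A R) && [forall i, al (tnth t i) == Some (tnth u i)]]
  | FEq x y => (al x != None) && (al x == al y)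
  | FNot g => ~~ sat al g
  | FAnd g h => sat al g && sat al h
  | FExists n x g =>
      n <= #|[set a : A | sat (fun y => if y == x then Some a else al y) g]|
  end.

Definition models (s : sign) (k : nat) (A : struct s) (f : form s k) : bool :=
  sat (fun _ : 'I_k => (None : option A)) f.

Definition Ck_equiv (s : sign) (k : nat) (A B : struct s) : Prop :=
  forall f : form s k, sentence f -> (models A f <-> models B f).

(* Main.v *)
Require Import Defs.
From HB Require Import structures.
From mathcomp Require Import all_boot all_order all_algebra.
From mathcomp Require Import fingroup perm.
From mathcomp Require Import finmap multiset.
From mathcomp Require Import boolp.
From mathcomp Require Import zify ring.

(** All three conditions say that Duplicator wins the bijective k-pebble game on
    A and B: there is a relation Z between A^k and B^k, total on both sides,
    that preserves equalities and relations and is such that, for Z-related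
    a and b and every position i, the multisets of Z-classes of the tuples
    a[i:=c] and b[i:=c] coincide.
    - C^k: winning positions satisfy the same formulae by induction; conversely
      "same C^k-type" is such a relation.
    - Homomorphism counts: along a tree decomposition with bags of size at most k,
      the count is a sum of products of Z-invariant factors, and leaf bags can be
      summed out one by one.  Conversely the functions a |-> hom((X, x), (A, a)),
      for X with a tree decomposition one of whose bags is the k-tuple x, are
      closed under products and under summation over one entry; a multiplicatively
      closed family of functions with equal sums has level sets of equal size.
    - Colour refinement: the colours of A^{*k} are Z-invariant, since the edges of
      the factor graph are projections, whose fibres are described by fixing some
      pebbles and summing over the others.  Conversely, for k >= 2, a[i:=c] is
      reached from a through its projection that forgets the entry i. *)

Set Implicit Arguments.
Unset Strict Implicit.
Unset Printing Implicit Defensive.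

Import GRing.Theory.

(** Invariance under Z is expressed through sums, not bijections: whenever [F] and [H] agree on
    related tuples, their sums over one moved pebble agree. Homomorphism counts, counting
    quantifiers and colour multisets all yield equalities of sums, and these survive grouping,
    exchange and factoring. A bijection is built only once, between the vertices of two factor
    graphs, from equal label counts.

    For homomorphism counts and for the logic, the way back to Z meets one obstacle: the condition
    speaks of closed objects, structures or sentences, whereas Z relates single tuples. For counts
    this dictates the presentation of X as a forest of k-tuples over a virtual root: product and
    summation over an entry become operations on forests, and only at the end is a forest turned
    into a structure. That last step is a quotient, because links and equality atoms may identify
    variables.

    The bound r <= k lets all entries of a constraint lie under pebbles at once. For k = 1 no
    projection can forget the only entry, since tuples in A^{*k} have positive length; there the
    relation on elements is compared with the game directly. *)

(** * Families with equal label counts *)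

Section Matching.
Variables (T U C : eqType) (p : T -> C) (q : U -> C).

(** Each [x] is paired with some [y] of the same label and both are removed. The labels are
    typically colours, and [F], [H] anything the colours determine. *)
Lemma sum_match (s1 : seq T) (s2 : seq U) (F : T -> nat) (H : U -> nat) :
  perm_eq (map p s1) (map q s2) ->
  (forall x y, x \in s1 -> y \in s2 -> p x = q y -> F x = H y) ->
  \sum_(x <- s1) F x = \sum_(y <- s2) H y.
Proof.
elim: s1 s2 => [|x s1 IH] s2 /=.
  by rewrite perm_sym => /perm_nilP/eqP; rewrite -size_eq0 size_map size_eq0 => /eqP-> _; rewrite !big_nil.
move=> e FH; have /mapP [y ys2 pxy] : p x \in map q s2 by rewrite -(perm_mem e) mem_head.
have ps := perm_to_rem ys2; rewrite (perm_big _ ps) /= !big_cons.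
congr (_ + _); first by apply: FH => //; exact: mem_head.
apply: IH => [|x' y' h1 h2]; last by apply: FH; [rewrite inE h1 orbT|exact: mem_rem h2].
by rewrite -(perm_cons (p x)) (perm_trans e) // pxy (perm_map q ps).
Qed.

Lemma perm_map_sum (s1 : seq T) (s2 : seq U) :
  (forall c, \sum_(x <- s1) (p x == c : nat) = \sum_(y <- s2) (q y == c : nat)) ->
  perm_eq (map p s1) (map q s2).
Proof.
move=> e; apply/allP => c _ /=; rewrite !count_map -!sum1_count.
by rewrite [X in X == _]big_mkcond [X in _ == X]big_mkcond; apply/eqP/e.
Qed.

End Matching.

(** Listing the labels of both sets gives two tuples with the same multiset of entries; the
    permutation between them, read through the enumerations, is the bijection. *)
Lemma matching_bij (T U : finType) (C : eqType) (p : T -> C) (q : U -> C) :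
  (forall c, \sum_x (p x == c : nat) = \sum_y (q y == c : nat)) ->
  exists f : T -> U, bijective f /\ forall x, q (f x) = p x.
Proof.
move=> e; have eTU : #|T| = #|U|.
  have /perm_size : perm_eq [seq p x | x <- enum T] [seq q y | y <- enum U].
    by apply: perm_map_sum => c; rewrite !big_enum.
  by rewrite !size_map => es; rewrite !cardT !enumT.
pose t1 : #|T|.-tuple C := [tuple p (enum_val i) | i < #|T|].
pose t2 : #|T|.-tuple C := [tuple q (enum_val (cast_ord eTU i)) | i < #|T|].
have : perm_eq t1 t2.
  apply: perm_map_sum => c; rewrite !big_enum /=.
  have := e c; rewrite (reindex _ (onW_bij _ (enum_val_bij T))) /= => ->.
  rewrite (reindex _ (onW_bij _ (enum_val_bij U))) /=.
  rewrite (reindex (cast_ord eTU)) //.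
  by exists (cast_ord (esym eTU)) => i _; rewrite ?cast_ordK ?cast_ordKV.
case/tuple_permP => pi epi.
pose f x := enum_val (cast_ord eTU (pi (enum_rank x))).
exists f; split.
  exists (fun y => enum_val ((pi^-1)%g (cast_ord (esym eTU) (enum_rank y)))) => x.
    by rewrite /f enum_valK cast_ordK permK enum_rankK.
  by rewrite /f enum_valK permKV cast_ordKV enum_rankK.
move=> x; have := congr1 (fun t => nth (p x) t (enum_rank x)) epi.
by rewrite -!tnth_nth !tnth_mktuple enum_rankK.
Qed.

Definition upd (X : finType) (T : Type) (h : {ffun X -> T}) (x : X) (c : T) :
  {ffun X -> T} := [ffun y => if y == x then c else h y].

(** * The bijective pebble game and invariant functions *)

Section Pebble.
Variables (s : sign) (k : nat) (A B : struct s).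

(** A winning strategy for Duplicator. Applied to indicators of the classes generated by [Z], clause
    [pb_sum] encodes the bijection that answers a move of pebble [i]. *)
Record pebble_bisim (Z : {ffun 'I_k -> A} -> {ffun 'I_k -> B} -> Prop) : Prop :=
  PebbleBisim {
  pb_eq : forall a b, Z a b -> forall i j, (a i == a j) = (b i == b j);
  pb_rel : forall a b, Z a b -> forall R (t : (ar R).-tuple 'I_k),
    (map_tuple a t \in rrel A R) = (map_tuple b t \in rrel B R);
  pb_sum : forall a b, Z a b -> forall i F H, (forall a b, Z a b -> F a = H b) ->
    \sum_c F (upd a i c) = \sum_c H (upd b i c) :> nat;
  pb_totl : forall a, exists b, Z a b;
  pb_totr : forall b, exists a, Z a b }.

Definition pebble_equiv := exists Z, pebble_bisim Z.

(* The elements of [D] sit under pebbles, [m x] being the pebble on [x]. *)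
Definition pebbled (Z : {ffun 'I_k -> A} -> {ffun 'I_k -> B} -> Prop) (X : finType)
    (D : {set X}) (h : {ffun X -> A}) (h' : {ffun X -> B}) :=
  exists (m : X -> 'I_k) a b, Z a b /\
    forall x, x \in D -> h x = a (m x) /\ h' x = b (m x).

Section Fixed.
Variables (Z : {ffun 'I_k -> A} -> {ffun 'I_k -> B} -> Prop) (bZ : pebble_bisim Z).
Variable X : finType.
Implicit Types (D W : {set X}).

Lemma pebbled_sub D D' h h' : D \subset D' -> pebbled Z D' h h' -> pebbled Z D h h'.
Proof.
by move=> /subsetP s1 [m [a [b [zab e]]]]; exists m, a, b; split=> // x /s1; apply: e.
Qed.

Lemma pebbled_eq D h h' x y : pebbled Z D h h' -> x \in D -> y \in D ->
  (h x == h y) = (h' x == h' y).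
Proof.
case=> m [a [b [zab e]]] xD yD.
by have [-> ->] := e _ xD; have [-> ->] := e _ yD; exact: pb_eq bZ _ _ zab _ _.
Qed.

Lemma pebbled_rel D h h' R (t : (ar R).-tuple X) : pebbled Z D h h' ->
  [set x in t] \subset D ->
  (map_tuple h t \in rrel A R) = (map_tuple h' t \in rrel B R).
Proof.
case=> m [a [b [zab e]]] /subsetP tD.
have -> : map_tuple h t = map_tuple a (map_tuple m t).
  apply: eq_from_tnth => i; rewrite !tnth_map.
  by have [] := e (tnth t i); rewrite ?tD ?inE ?mem_tnth.
have -> : map_tuple h' t = map_tuple b (map_tuple m t).
  apply: eq_from_tnth => i; rewrite !tnth_map.
  by have [] := e (tnth t i); rewrite ?tD ?inE ?mem_tnth.
exact: pb_rel bZ _ _ zab _ _.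
Qed.

Definition pinvariant D (F : {ffun X -> A} -> nat) (H : {ffun X -> B} -> nat) :=
  forall h h', pebbled Z D h h' -> F h = H h'.

(** Without [x], the set [D] needs at most [k - 1] pebbles, so some pebble [i] is free to be placed
    on [x]; summing over the value at [x] is then a move of that pebble. *)
Lemma pinvariant_sum1 D x F H : x \in D -> #|D| <= k -> pinvariant D F H ->
  pinvariant (D :\ x) (fun h => \sum_c F (upd h x c)) (fun h' => \sum_c H (upd h' x c)).
Proof.
move=> xD Dk FH h h' [m [a [b [zab e]]]].
have [i iP] : exists i, i \notin m @: (D :\ x).
  apply/existsP; rewrite -negb_forall; apply/negP => /forallP al.
  have : #|m @: (D :\ x)| = k.
    by rewrite -[RHS]card_ord; apply: eq_card => j; rewrite al.
  move=> ek; have := leq_imset_card m (D :\ x); rewrite ek => l1.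
  by have := cardsD1 x D; rewrite xD; lia.
pose m' y := if y == x then i else m y.
(* [ext] reads the values on [D] off the pebbles and keeps [g] elsewhere, so that updating [u] at
   [i] amounts to updating [g] at [x]. *)
pose ext (T : struct s) (g : {ffun X -> T}) (u : {ffun 'I_k -> T}) : {ffun X -> T} :=
  [ffun y => if y \in D then u (m' y) else g y].
have extE (T : struct s) (g : {ffun X -> T}) (u : {ffun 'I_k -> T}) c :
  (forall y, y \in D :\ x -> g y = u (m y)) -> ext T g (upd u i c) = upd g x c.
  move=> eg; apply/ffunP => y; rewrite !ffunE /m'.
  have [->|yx] := eqVneq y x; first by rewrite xD eqxx.
  case: ifP => // yD; have yDx : y \in D :\ x by rewrite !inE yx.
  have [miy|_] := eqVneq (m y) i; last by rewrite eg.
  by case/negP: iP; rewrite -miy imset_f.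
under eq_bigr => c _ do rewrite -(extE A h a c (fun y yD => proj1 (e y yD))).
under [RHS]eq_bigr => c _ do rewrite -(extE B h' b c (fun y yD => proj2 (e y yD))).
apply: (pb_sum bZ zab i (F := fun u => F (ext A h u)) (H := fun u => H (ext B h' u))).
move=> u v zuv; apply: FH; exists m', u, v; split=> // y yD.
by rewrite !ffunE yD.
Qed.

Definition agree (T : finType) (W : {set X}) (h g : {ffun X -> T}) :=
  [forall y, (y \notin W) ==> (g y == h y)].

Lemma agree0 (T : finType) (h g : {ffun X -> T}) : agree set0 h g = (g == h).
Proof.
apply/forallP/eqP => [e|-> y]; last by rewrite eqxx implybT.
by apply/ffunP => y; have := e y; rewrite inE => /eqP.
Qed.

Lemma agree_split (T : finType) (W : {set X}) x (h : {ffun X -> T}) (F : {ffun X -> T} -> nat) :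
  x \in W -> \sum_(g | agree W h g) F g =
  \sum_c \sum_(g | agree (W :\ x) (upd h x c) g) F g.
Proof.
move=> xW; rewrite (partition_big (fun g : {ffun X -> T} => g x) predT) //=.
apply: eq_bigr => c _; apply: eq_bigl => g.
apply/andP/forallP => [[/forallP e /eqP gx] y|e].
  rewrite !inE ffunE; case: eqVneq => [->|yx] /=; first by rewrite gx.
  exact: e.
split; last by have := e x; rewrite !inE eqxx ffunE eqxx.
apply/forallP => y; apply/implyP => yW; have := e y; rewrite !inE ffunE (negbTE yW) andbF /=.
by case: (eqVneq y x) yW => [->|//]; rewrite xW.
Qed.

Lemma pinvariant_sum D W F H : W \subset D -> #|D| <= k -> pinvariant D F H ->
  pinvariant (D :\: W) (fun h => \sum_(g | agree W h g) F g)
    (fun h' => \sum_(g' | agree W h' g') H g').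
Proof.
elim: {W}#|W| {-2}W (erefl #|W|) => [|n IH] W.
  move=> /eqP; rewrite cards_eq0 => /eqP-> _ _ FH h h'; rewrite setD0 => z.
  rewrite (big_pred1 h) => [|g]; last exact: agree0.
  by rewrite (big_pred1 h') => [|g]; [exact: FH|exact: agree0].
move=> eW WD Dk FH.
have [x xW] : exists x, x \in W by apply/set0Pn; rewrite -cards_eq0 eW.
have FH' := IH (W :\ x) _ _ Dk FH.
have {}FH' : pinvariant (D :\: (W :\ x)) (fun h => \sum_(g | agree (W :\ x) h g) F g)
    (fun h' => \sum_(g' | agree (W :\ x) h' g') H g').
  apply: FH'; first by move: eW; rewrite (cardsD1 x) xW => -[].
  exact: subset_trans (subsetDl _ _) WD.
have -> : D :\: W = (D :\: (W :\ x)) :\ x.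
  by apply/setP => y; rewrite !inE; case: eqVneq => // ->; rewrite xW.
move=> h h' z; rewrite (agree_split _ _ xW) (agree_split _ _ xW).
apply: pinvariant_sum1 FH' _ _ z; first by rewrite !inE eqxx (subsetP WD).
by apply: leq_trans Dk; apply/subset_leq_card/subsetDl.
Qed.

End Fixed.
End Pebble.

(** * Multiplicatively closed families with equal sums *)

Section Separation.
Variables (T U : finType) (K : Type) (f : K -> T -> nat) (g : K -> U -> nat).
Variables (one : K) (mul : K -> K -> K).
Hypothesis f1 : forall x, f one x = 1.
Hypothesis g1 : forall y, g one y = 1.
Hypothesis fM : forall p q x, f (mul p q) x = f p x * f q x.
Hypothesis gM : forall p q y, g (mul p q) y = g p y * g q y.
Hypothesis fg_sum : forall p, \sum_x f p x = \sum_y g p y.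

(** Both families are merged on the disjoint union, so that one class can have points on either
    side. *)
Let val2 p (w : T + U) : nat := match w with inl x => f p x | inr y => g p y end.
Let sep (w z : T + U) : bool := `[< forall p, val2 p w = val2 p z >].

(* The product of the [f_z - f_z(z)] over the points [z] separated from [w]
   is a combination of members of the family that vanishes off the class of [w]. *)
Lemma separated_card (w : T + U) :
  \sum_x (sep w (inl x) : nat) = \sum_y (sep w (inr y) : nat).
Proof.
have /choice [sp spP] : forall z, exists p, ~~ sep w z -> val2 p w != val2 p z.
  move=> z; have [_|/asboolPn/existsNP [p /eqP pP]] := boolP (sep w z).
    by exists one.
  by exists p.
pose zs := [seq z <- enum {: T + U} | ~~ sep w z].
pose P (r : seq (T + U)) (v : T + U) : int :=
  (\prod_(z <- r) ((val2 (sp z) v)%:Z - (val2 (sp z) z)%:Z))%R.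
have sumZ (V : finType) (G : V -> nat) : (\sum_v (G v)%:Z = (\sum_v G v)%:Z)%R.
  exact/esym/(big_morph Posz PoszD).
(* Stated for every [p], because expanding the factor of [z] replaces [p] by [mul (sp z) p]. The
   factors are differences, hence the integers. *)
have sumP r p : (\sum_x P r (inl x) * (f p x)%:Z = \sum_y P r (inr y) * (g p y)%:Z)%R.
  elim: r p => [|z r IH] p.
    under eq_bigr => x _ do rewrite /P big_nil mul1r.
    under [RHS]eq_bigr => x _ do rewrite /P big_nil mul1r.
    by rewrite !sumZ fg_sum.
  have PE v : (P (z :: r) v * (val2 p v)%:Z = P r v * (val2 (mul (sp z) p) v)%:Z -
      (val2 (sp z) z)%:Z * (P r v * (val2 p v)%:Z))%R.
    have -> : val2 (mul (sp z) p) v = val2 (sp z) v * val2 p v by case: v => v /=.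
    by rewrite /P big_cons PoszM; ring.
  under eq_bigr => x _ do rewrite (PE (inl x)).
  under [RHS]eq_bigr => x _ do rewrite (PE (inr x)).
  by rewrite !big_split /= !sumrN -!mulr_sumr !IH.
have PE v : P zs v = (P zs w * (sep w v : nat)%:Z)%R.
  have [svw|svw] := boolP (sep w v).
    rewrite mulr1; apply: eq_bigr => z _; congr (_%:Z - _)%R.
    by have /asboolP := svw => /(_ (sp z)).
  rewrite mulr0 /P (bigD1_seq v) /=; first by rewrite subrr mul0r.
    by rewrite mem_filter svw mem_enum.
  exact/filter_uniq/enum_uniq.
have Pw : P zs w != 0%R.
  rewrite prodf_seq_neq0; apply/allP => z; rewrite mem_filter => /andP [zw _].
  by rewrite subr_eq0 eqz_nat spP.
have := sumP zs one.
have -> : (\sum_x P zs (inl x) * (f one x)%:Z = \sum_x P zs w * (sep w (inl x) : nat)%:Z)%R.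
  by apply: eq_bigr => x _; rewrite f1 mulr1 PE.
have -> : (\sum_y P zs (inr y) * (g one y)%:Z = \sum_y P zs w * (sep w (inr y) : nat)%:Z)%R.
  by apply: eq_bigr => x _; rewrite g1 mulr1 PE.
rewrite -!mulr_sumr => /(mulfI Pw) /eqP.
by rewrite !sumZ eqz_nat => /eqP.
Qed.

(** The class of [x] contains [x], so by [separated_card] it has a point on the other side too. *)
Lemma separated_partner x : exists y, forall p, f p x = g p y.
Proof.
have := separated_card (inl x); rewrite (bigD1 x) //=.
have -> : sep (inl x) (inl x) by apply/asboolP.
case: (pselect (exists y, sep (inl x) (inr y))) => [[y /asboolP yP] _|no].
  by exists y => p; have := yP p.
rewrite [RHS]big1 => [|y _]; first by rewrite addSn.
by apply/eqP; rewrite eqb0; apply/negP => yx; apply: no; exists y.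
Qed.

Lemma separated_sum (F : T -> nat) (H : U -> nat) :
  (forall x y, (forall p, f p x = g p y) -> F x = H y) -> \sum_x F x = \sum_y H y.
Proof.
(* A class is replaced by its characteristic function, a label that [sum_match] can compare across
   the two sides. *)
move=> FH; pose cls w : {ffun T + U -> bool} := [ffun z => sep w z].
have clsE v w : (cls v == cls w) = sep w v.
  apply/eqP/asboolP => [e p|e].
    have : cls v v by rewrite ffunE; apply/asboolP.
    by rewrite e ffunE => /asboolP.
  apply/ffunP => z; rewrite !ffunE; apply/asboolP/asboolP => e' p.
    by rewrite e e'.
  by rewrite -e e'.
rewrite -!big_enum /=.
apply: (@sum_match _ _ _ (fun x => cls (inl x)) (fun y => cls (inr y))); last first.
  by move=> x y _ _ e; apply: FH => p; move/eqP: e; rewrite clsE => /asboolP /(_ p).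
apply: perm_map_sum => c; rewrite !big_enum /=.
have [[w ->]|no] := pselect (exists w, c = cls w).
  under eq_bigr => x _ do rewrite clsE.
  under [RHS]eq_bigr => x _ do rewrite clsE.
  exact: separated_card.
by rewrite !big1 // => x _; apply/eqP; rewrite eqb0; apply/eqP => e; apply: no; eexists; rewrite -e.
Qed.

End Separation.

(** * Counting logic *)

Section Logic.
Variables (s : sign) (k : nat).
Implicit Types (A B : struct s) (f : Defs.form s k).

Lemma sat_ext A (al be : 'I_k -> option A) f : al =1 be -> sat al f = sat be f.
Proof. by move=> /funext ->. Qed.

(** [sat] works with partial assignments, while placements of pebbles are total: the two must be
    defined at the same variables and follow the pebbles there. *)
Definition pebbled_assignments A B (Z : {ffun 'I_k -> A} -> {ffun 'I_k -> B} -> Prop)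
    (al : 'I_k -> option A) (be : 'I_k -> option B) :=
  exists a b, Z a b /\ forall x,
    (al x = None /\ be x = None) \/ (al x = Some (a x) /\ be x = Some (b x)).

Lemma sat_rel_some A (al : 'I_k -> option A) R (t : (ar R).-tuple 'I_k) (a : {ffun 'I_k -> A}) :
  (forall i, al (tnth t i) = Some (a (tnth t i))) ->
  sat al (FRel t) = (map_tuple a t \in rrel A R).
Proof.
move=> e /=; apply/existsP/idP => [[u /andP [uR /forallP eu]]|tR].
  suff -> : map_tuple a t = u by [].
  by apply: eq_from_tnth => i; rewrite tnth_map; have := eu i; rewrite e => /eqP [].
by exists (map_tuple a t); rewrite tR /=; apply/forallP => i; rewrite e tnth_map.
Qed.

Lemma sat_rel_none A (al : 'I_k -> option A) R (t : (ar R).-tuple 'I_k) i :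
  al (tnth t i) = None -> sat al (FRel t) = false.
Proof.
move=> e /=; apply/existsP => -[u /andP [_ /forallP /(_ i)]].
by rewrite e.
Qed.

Lemma sat_pebbled A B (Z : {ffun 'I_k -> A} -> {ffun 'I_k -> B} -> Prop) :
  pebble_bisim Z -> forall f al be, pebbled_assignments Z al be -> sat al f = sat be f.
Proof.
move=> bZ; elim=> [R t|x y|f IH|f IHf g IHg|n x f IH] al be zab.
- have [a [b [zab' e]]] := zab.
  have [[i ei]|no] := pselect (exists i, al (tnth t i) = None).
    rewrite (sat_rel_none ei); apply/esym/(@sat_rel_none _ _ _ _ i).
    by have [[]|[]] := e (tnth t i); rewrite ei.
  rewrite (@sat_rel_some _ _ _ _ a) => [|i]; last first.
    by have [[e1 _]|[-> //]] := e (tnth t i); case: no; exists i.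
  rewrite (@sat_rel_some _ _ _ _ b) => [|i]; first exact: pb_rel bZ _ _ zab' _ _.
  by have [[e1 _]|[_ -> //]] := e (tnth t i); case: no; exists i.
- have [a [b [zab' e]]] := zab => /=.
  have := e x; have := e y => -[[-> ->]|[-> ->]] [[-> ->]|[-> ->]] //=.
  exact: pb_eq bZ _ _ zab' _ _.
- by rewrite /= (IH _ _ zab).
- by rewrite /= (IHf _ _ zab) (IHg _ _ zab).
have [a [b [zab' e]]] := zab => /=; congr (n <= _).
rewrite -!sum1_card [LHS]big_mkcond [RHS]big_mkcond /=.
(* [ext] restricts a total placement to the domain of [ga] extended by [x]; the number of witnesses
   becomes a sum over one moved pebble. *)
pose ext (T : struct s) (ga : 'I_k -> option T) (c : {ffun 'I_k -> T}) :=
  fun y => if y == x then Some (c x) else if ga y is Some _ then Some (c y) else None.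
have := @pb_sum _ _ _ _ _ bZ _ _ zab' x (fun c => nat_of_bool (sat (ext A al c) f))
    (fun c => nat_of_bool (sat (ext B be c) f)).
have extE (T : struct s) (ga : 'I_k -> option T) (c : {ffun 'I_k -> T}) d :
   (forall y, ga y = None \/ ga y = Some (c y)) ->
   ext T ga (upd c x d) = fun y => if y == x then Some d else ga y.
  move=> h; apply/funext => y; rewrite /ext /upd !ffunE eqxx.
  by case: eqP => // _; case: (h y) => ->.
move=> h; transitivity (\sum_c nat_of_bool (sat (ext A al (upd a x c)) f)).
  apply: eq_bigr => c _; rewrite inE extE => [|y]; first by case: sat.
  by have [[]|[]] := e y; [left|right].
rewrite h; last first.
  move=> c d zcd; congr nat_of_bool; apply: IH; exists c, d; split=> // y; rewrite /ext.
  case: eqP => [->|_]; first by right.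
  by have [[-> ->]|[-> ->]] := e y; [left|right].
apply: eq_bigr => c _; rewrite inE extE => [|y]; first by case: sat.
by have [[]|[]] := e y; [left|right].
Qed.

(** Empty universes admit no placement of pebbles and are treated apart. Assignments are undefined
    everywhere, relational atoms fail because arities are positive, and quantifiers count empty
    sets. *)
Lemma sat_empty A B (al : 'I_k -> option A) (be : 'I_k -> option B) f :
  (forall R : s, 0 < ar R) -> #|A| = 0 -> #|B| = 0 -> sat al f = sat be f.
Proof.
move=> ar0 A0 B0; have noA (a : A) : False by have := fintype0 a A0.
have noB (b : B) : False by have := fintype0 b B0.
elim: f al be => [R t|x y|f IH|f IHf g IHg|n x f IH] al be.
- have i0 := Ordinal (ar0 R); rewrite (@sat_rel_none _ al R t i0).
    apply/esym; apply: (@sat_rel_none _ be R t i0).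
    by case: (be _) => // b; case: (noB b).
  by case: (al _) => // b; case: (noA b).
- rewrite /=; case: (al x) => [b|]; first by case: (noA b).
  by case: (be x) => [b|] //; case: (noB b).
- by rewrite /= (IH al be).
- by rewrite /= (IHf al be) (IHg al be).
have cz (T : finType) (S : {set T}) : #|T| = 0 -> #|S| = 0.
  by move=> T0; apply/eqP; rewrite -leqn0 -T0 max_card.
by rewrite /= !cz.
Qed.

Lemma pebble_equiv_empty A B : pebble_equiv k A B -> 0 < k -> (#|A| = 0) <-> (#|B| = 0).
Proof.
case=> Z bZ k0; split=> e0.
  have [//|/card_gt0P [b _]] := posnP #|B|; have [a _] := pb_totr bZ [ffun=> b].
  by have := fintype0 (a (Ordinal k0)) e0.
have [//|/card_gt0P [a _]] := posnP #|A|; have [b _] := pb_totl bZ [ffun=> a].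
by have := fintype0 (b (Ordinal k0)) e0.
Qed.

Lemma pebble_equiv_Ck A B : (forall R : s, 0 < ar R) -> 0 < k ->
  pebble_equiv k A B -> Ck_equiv k A B.
Proof.
move=> ar0 k0 eAB f _; suff -> : models A f = models B f by [].
have [A0|] := posnP #|A|.
  by apply: sat_empty => //; apply/(pebble_equiv_empty eAB k0).
case/card_gt0P => a _; case: eAB => Z bZ; have [b zab] := pb_totl bZ [ffun=> a].
by apply: (sat_pebbled bZ); exists [ffun=> a], b; split=> // x; left.
Qed.

Definition ex_all (xs : seq 'I_k) f : Defs.form s k := foldr (fun x g => FExists 1 x g) f xs.

Lemma sat_ex_all_some A (a : {ffun 'I_k -> A}) f xs (al : 'I_k -> option A) :
  (forall y, y \notin xs -> al y = Some (a y)) -> sat (Some \o a) f -> sat al (ex_all xs f).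
Proof.
move=> h sf; elim: xs al h => [|x xs IH] al h /=.
  by rewrite (@sat_ext _ _ (Some \o a)) // => y; rewrite h.
apply/card_gt0P; exists (a x); rewrite inE; apply: IH => y yxs.
by case: eqP => [->|/eqP yx] //; rewrite h // inE negb_or yx.
Qed.

Lemma sat_ex_all A f xs (al : 'I_k -> option A) :
  (forall y, y \notin xs -> al y != None) -> sat al (ex_all xs f) ->
  exists a : {ffun 'I_k -> A}, sat (Some \o a) f.
Proof.
elim: xs al => [|x xs IH] al h /=.
  move=> sf; have /choice [a aP] : forall y, exists c, al y = Some c.
    by move=> y; have := h y isT; case: (al y) => // c _; exists c.
  by exists (finfun a); rewrite (@sat_ext _ _ al) // => y /=; rewrite ffunE aP.
case/card_gt0P => c; rewrite inE; apply: IH => y yxs.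
by case: (eqVneq y x) => [//|yx]; apply: h; rewrite inE negb_or yx.
Qed.

Lemma free_ex_all f xs : Defs.free (ex_all xs f) = Defs.free f :\: [set x in xs].
Proof.
elim: xs => [|x xs IH] /=; first by apply/setP => y; rewrite !inE.
by rewrite IH; apply/setP => y; rewrite !inE negb_or andbA.
Qed.

Definition same_type A B (a : {ffun 'I_k -> A}) (b : {ffun 'I_k -> B}) :=
  forall f, sat (Some \o a) f = sat (Some \o b) f.

(** If no [b] had the type of [a], each of the finitely many [b] would fail some formula true at
    [a]. The existential closure of their conjunction would be a sentence true in [A] and false in
    [B]. *)
Lemma Ck_total A B : 0 < k -> Ck_equiv k A B ->
  forall a : {ffun 'I_k -> A}, exists b : {ffun 'I_k -> B}, same_type a b.
Proof.
move=> k0 eAB a; have [//|no] := pselect (exists b : {ffun 'I_k -> B}, same_type a b).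
have /choice [sp spP] : forall b : {ffun 'I_k -> B}, exists f,
    sat (Some \o a) f /\ ~~ sat (Some \o b) f.
  move=> b; have /existsNP [f /eqP ne] : ~ same_type a b by move=> z; apply: no; exists b.
  have [sa|sa] := boolP (sat (Some \o a) f).
    by exists f; split=> //; move: ne; rewrite sa; case: sat.
  by exists (FNot f); rewrite /= sa; split=> //; move: ne; rewrite (negbTE sa); case: sat.
pose x0 := Ordinal k0.
(* The trivial equality stands for the empty conjunction; it holds under total assignments. *)
pose F := foldr (fun b g => FAnd (sp b) g) (FEq s x0 x0) (enum {: {ffun 'I_k -> B}}).
have sF : sat (Some \o a) F.
  by rewrite /F; elim: (enum _) => [|b r IH] /=; rewrite ?eqxx // (spP b).1.
have sent : sentence (ex_all (enum 'I_k) F).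
  rewrite /sentence free_ex_all; apply/eqP/setP => y.
  by rewrite !inE mem_enum.
have mA : models A (ex_all (enum 'I_k) F).
  by apply: (@sat_ex_all_some _ a) => // y; rewrite mem_enum.
have /sat_ex_all [|b] := (eAB _ sent).1 mA; first by move=> y; rewrite mem_enum.
have: b \in enum {: {ffun 'I_k -> B}} by rewrite mem_enum.
rewrite /F; elim: (enum _) => [//|c r IH] /=; rewrite inE => /orP [/eqP <-|br] /andP [sb sr].
  by move: sb; rewrite (negbTE (spP b).2).
exact: IH.
Qed.

(** Conjunction multiplies truth values, so the formulae form a multiplicatively closed family of
    0-1 functions, and counting quantifiers equate the sums. *)
Lemma Ck_pebble_equiv A B : 0 < k -> Ck_equiv k A B -> pebble_equiv k A B.
Proof.
move=> k0 eAB; exists (@same_type A B); split.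
- by move=> a b z i j; have := z (FEq s i j).
- move=> a b z R t; have := z (FRel t).
  by rewrite (@sat_rel_some _ _ _ _ a) // (@sat_rel_some _ _ _ _ b).
- move=> a b z i F H FH; pose x0 := Ordinal k0.
  apply: (@separated_sum A B (Defs.form s k) (fun f c => sat (Some \o upd a i c) f)
    (fun f c => sat (Some \o upd b i c) f) (FEq s x0 x0) (@FAnd s k)).
  + by move=> c /=; rewrite eqxx.
  + by move=> c /=; rewrite eqxx.
  + by move=> f g c /=; rewrite mulnb.
  + by move=> f g c /=; rewrite mulnb.
  + move=> f; have updE (T : struct s) (d : {ffun 'I_k -> T}) :
      \sum_c (sat (Some \o upd d i c) f : nat) =
      #|[set c | sat (fun y => if y == i then Some c else (Some \o d) y) f]|.
      rewrite -sum1_card [RHS]big_mkcond /=; apply: eq_bigr => c _; rewrite inE.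
      rewrite (@sat_ext _ _ (fun y => if y == i then Some c else Some (d y))).
        by case: sat.
      by move=> y; rewrite /= ffunE; case: eqP.
    (* The formulae [FExists q i f], for all thresholds [q], determine the number of witnesses. *)
    rewrite !updE; set m := #|_|; set n := #|_|; apply/eqP; rewrite eqn_leq.
    have h q : (q <= m) = (q <= n) := z (FExists q i f).
    by rewrite -h leqnn h leqnn.
  + by move=> c d e; apply: FH => f; have := e f; do 2 case: sat.
- exact: Ck_total.
- move=> b; have [a z] := Ck_total k0 (fun f sf => iff_sym (eAB f sf)) b.
  by exists a => f; rewrite z.
Qed.

End Logic.

(** * Homomorphism counts *)

(* The running intersection property, for a list whose last bag is the root. *)
Fixpoint running_intersection (V : finType) (Ds : seq {set V}) : Prop :=
  if Ds is D :: Ds' then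
    (D :&: \bigcup_(E <- Ds') E = set0 \/
     exists2 D', D' \in Ds' & D :&: \bigcup_(E <- Ds') E \subset D') /\ running_intersection Ds'
  else True.

(** * From a tree decomposition to a list of bags with running intersections *)

Section TreeOrder.
Variables (n : nat) (E : rel 'I_n) (V : finType) (b : 'I_n -> {set V}).
Hypothesis treeE : is_tree E.
Hypothesis conn_b : forall (x : V) (u v : 'I_n), x \in b u -> x \in b v ->
  connect (fun p q => [&& E p q, x \in b p & x \in b q]) u v.

Let inside (s : seq 'I_n) : rel 'I_n := fun p q => [&& E p q, p \in s & q \in s].

Lemma path_first_in (e : rel 'I_n) (s : seq 'I_n) v p :
  path e v p -> last v p \in s ->  v \notin s ->
  exists p1 w, [/\ path e v (rcons p1 w), w \in s, {in p1, forall z, z \notin s} &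
     subseq (rcons p1 w) p].
Proof.
elim: p v => [|y p IH] v /=; first by move=> _ ->.
case/andP => vy yp lp vs; have [ys|ys] := boolP (y \in s).
  by exists [::], y; rewrite /= vy ys eqxx sub0seq; split.
have [p1 [w [pw ws p1s sub]]] := IH y yp lp ys.
exists (y :: p1), w; split=> //=; first by rewrite vy.
  by move=> z; rewrite inE => /orP [/eqP->|/p1s].
by rewrite eqxx.
Qed.

Lemma connect_path (T : finType) (e : rel T) x y : connect e x y ->
  exists p, [/\ path e x p, last x p = y & uniq (x :: p)].
Proof.
by move=> /connectP [p ep ->]; case/shortenP: ep => p' ep' up' _; exists p'.
Qed.

(** Suppose [x] lies in the bag of [v] and in a bag of [s]. The path between them through bags
    containing [x] first enters [s] at some [w']. If [w'] were not [u], continuing inside [s] to [u]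
    and back to [v] would close a cycle; hence [x] is in the bag of [u]. *)
Lemma tree_attach (s : seq 'I_n) u v :
  {in s &, forall x y, connect (inside s) x y} -> u \in s -> v \notin s -> E u v ->
  b v :&: \bigcup_(w <- s) b w \subset b u.
Proof.
case: treeE => _ symE irrE _ acyc cs us vs uv; apply/subsetP => x.
rewrite inE => /andP [xv]; rewrite bigcup_seq => /bigcupP [w ws xw].
have [p [ep lp up]] := connect_path (conn_b xv xw).
have := path_first_in ep _ vs; rewrite lp => /(_ ws) [p1 [w' [ep1 w's p1s sub]]].
have xw' : x \in b w'.
  by have := ep1; rewrite rcons_path => /andP [_ /and3P []].
have [<- //|nuw] := eqVneq w' u; case: acyc.
have [q [epq lq uq]] := connect_path (cs _ _ w's us).
have qs : {in q, forall z, z \in s}.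
  elim: (q) (w') epq => //= y r IH w1 /andP [/and3P [_ _ ys] er] z.
  by rewrite inE => /orP [/eqP -> //|]; apply: IH er z.
have q0 : q != [::] by case: (q) lq nuw => //= ->; rewrite eqxx.
exists v, (rcons p1 w' ++ q); split.
- by rewrite size_cat size_rcons addSn ltnS; case: (q) q0 => //= y r _; rewrite addnS.
- rewrite -cat_cons cat_uniq; apply/and3P; split.
  + by apply: subseq_uniq up; rewrite /= eqxx.
  + apply/hasPn => z zq; rewrite inE mem_rcons inE !negb_or.
    have zs := qs z zq; have := uq; rewrite /= => /andP [w'q _].
    rewrite (contraNneq _ vs) => [|<- //]; rewrite (contraNneq _ w'q) => [|<- //].
    by apply/negP => /p1s; rewrite zs.
  + by have := uq; rewrite /= => /andP [].
- rewrite cat_path last_rcons; apply/andP; split.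
    by apply: sub_path ep1 => y z /and3P [].
  by apply: sub_path epq => y z /and3P [].
by rewrite last_cat last_rcons lq.
Qed.

(** On a path from an outside node into [s], the last node before the first entry is adjacent to
    [s]; it is put in front and [tree_attach] applies. *)
Lemma tree_grow m : 0 < m <= n -> exists s : seq 'I_n,
  [/\ uniq s, size s = m, {in s &, forall x y, connect (inside s) x y} & running_intersection (map b s)].
Proof.
have [n0 symE _ cE _] := treeE.
elim: m => [//|[|m] IH] mn.
  exists [:: Ordinal n0]; split=> //=; last by split=> //; left; rewrite big_nil setI0.
  by move=> x y; rewrite !inE => /eqP-> /eqP->; exact: connect0.
have [s [us ss cs rs]] := IH (ltnW mn).
have [v vs] : exists v, v \notin s.
  apply/existsP; rewrite -negb_forall; apply/negP => /forallP al.
  have : #|[set: 'I_n]| <= size s.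
    by apply: leq_trans (card_size s); apply/subset_leq_card/subsetP => z _; apply: al.
  by rewrite cardsT card_ord ss leqNgt (andP mn).2.
case es : s => [|r s'] //; first by rewrite es in ss.
have rs' : r \in s by rewrite es mem_head.
have [p [ep lp _]] := connect_path (cE v r).
have := path_first_in ep; rewrite lp => /(_ s rs' vs) [p1 [w [ep1 ws p1s _]]].
pose v' := last v p1.
have v's : v' \notin s.
  by rewrite /v'; case: (p1) (mem_last v p1) p1s => //= y p2 ml h; apply: h; apply: mem_last.
have wv' : E w v' by rewrite symE; move: ep1; rewrite rcons_path => /andP [].
exists (v' :: s); split => /=.
- by rewrite v's us.
- by rewrite ss.
- have sub x y : x \in s -> y \in s -> connect (inside (v' :: s)) x y.
    move=> xs ys; apply: connect_sub (cs x y xs ys) => c d /and3P [cd c1 d1].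
    by apply: connect1; rewrite /inside cd !inE c1 d1 !orbT.
  have wv : connect (inside (v' :: s)) w v'.
    by apply: connect1; rewrite /inside wv' !inE ws eqxx orbT.
  have vw : connect (inside (v' :: s)) v' w.
    by apply: connect1; rewrite /inside symE wv' !inE ws eqxx orbT.
  move=> x y; rewrite !inE => /orP [/eqP->|xs] /orP [/eqP->|ys].
  + exact: connect0.
  + exact: connect_trans vw (sub _ _ ws ys).
  + exact: connect_trans (sub _ _ xs ws) wv.
  + exact: sub.
split=> //; right; exists (b w); first exact: map_f.
by rewrite big_map; apply: tree_attach.
Qed.

Lemma tree_order : exists s : seq 'I_n, [/\ uniq s, forall v, v \in s & running_intersection (map b s)].
Proof.
have [n0 _ _ _ _] := treeE; have [|s [us ss _ rs]] := @tree_grow n; first by rewrite n0 leqnn.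
have sub : {subset s <= enum 'I_n} by move=> x _; rewrite mem_enum.
have le : size (enum 'I_n) <= size s by rewrite ss size_enum_ord.
by exists s; split=> // v; have [_ ->] := uniq_min_size us sub le; rewrite mem_enum.
Qed.

End TreeOrder.

(** * Summing out the bags *)

Section LocalFactors.
Variables (s : sign) (k : nat) (A B : struct s).
Variables (Z : {ffun 'I_k -> A} -> {ffun 'I_k -> B} -> Prop) (bZ : pebble_bisim Z).
Variables (a0 : {ffun 'I_k -> A}) (b0 : {ffun 'I_k -> B}) (z0 : Z a0 b0) (i0 : 'I_k).
Variable V : finType.

Lemma pebbled0 (h : {ffun V -> A}) (h' : {ffun V -> B}) : pebbled Z set0 h h'.
Proof. by exists (fun _ => i0), a0, b0; split=> // x; rewrite inE. Qed.

(** Indices in [enum D] give the elements of [D] distinct pebbles, the spare pebbles follow [a0],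
    and totality of [Z] answers the placement. *)
Lemma pebbled_exists (D : {set V}) (h : {ffun V -> A}) : #|D| <= k ->
  exists h' : {ffun V -> B}, pebbled Z D h h'.
Proof.
move=> Dk; pose m x : 'I_k := insubd i0 (index x (enum D)).
have mE x : x \in D -> m x = index x (enum D) :> nat.
  move=> xD; rewrite insubdK // unfold_in /=; apply: leq_trans Dk.
  by rewrite cardE index_mem mem_enum.
have mI : {in D &, injective m}.
  move=> x y xD yD /(congr1 (@nat_of_ord k)); rewrite !mE // => e.
  by rewrite -(nth_index x (s := enum D) (x := x)) ?mem_enum // e nth_index ?mem_enum.
pose a := [ffun i => if [pick x | (x \in D) && (m x == i)] is Some x then h x else a0 i].
have [b zab] := pb_totl bZ a.
exists [ffun x => b (m x)], m, a, b; split=> // x xD; rewrite !ffunE; split=> //.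
case: pickP => [y /andP [yD /eqP /mI -> //]|/(_ x)].
by rewrite xD eqxx.
Qed.

(** A partner of [h] on [D] is equally a partner of [g], so both values equal the value of [H] at
    that partner. *)
Lemma pinvariant_local (D W : {set V}) (F : {ffun V -> A} -> nat) (H : {ffun V -> B} -> nat) (g h : {ffun V -> A}) :
  #|D| <= k -> pinvariant Z D F H -> [disjoint D & W] -> agree W h g -> F g = F h.
Proof.
move=> Dk FH DW /forallP hg; have [h' z] := pebbled_exists h Dk.
rewrite (FH _ _ z); apply: FH; case: z => m [a [b [zab e]]].
exists m, a, b; split=> // x xD; have [<- ?] := e x xD; split=> //.
by have := hg x; rewrite (disjointFr DW xD) => /eqP.
Qed.
End LocalFactors.

Lemma agree_sym (V T : finType) (W : {set V}) (g h : {ffun V -> T}) : agree W h g = agree W g h.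
Proof. by apply: eq_forallb => y; rewrite eq_sym. Qed.

(** Functions keep all of [V] as domain, so summing out [W] leaves idle coordinates: each [F g] is
    met once for every function agreeing with [g] off [W], which is [N] times. *)
Lemma sum_eliminate (V T : finType) (W : {set V}) (F P : {ffun V -> T} -> nat) N :
  (forall g h : {ffun V -> T}, agree W h g -> P g = P h) ->
  (forall h : {ffun V -> T}, \sum_(g | agree W h g) 1 = N) ->
  \sum_h (\sum_(g | agree W h g) F g) * P h = N * \sum_h F h * P h.
Proof.
move=> PW NW; under eq_bigr => h _ do rewrite big_distrl /=.
rewrite (exchange_big_dep predT) //= big_distrr /=; apply: eq_bigr => g _.
rewrite -(NW g) big_distrl /=; apply: eq_big => h; first exact: agree_sym.
by move=> hg; rewrite mul1n (PW _ _ hg).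
Qed.

Section FactorElimination.
Variables (s : sign) (k : nat) (A B : struct s).
Variables (Z : {ffun 'I_k -> A} -> {ffun 'I_k -> B} -> Prop) (bZ : pebble_bisim Z).
Variables (a0 : {ffun 'I_k -> A}) (b0 : {ffun 'I_k -> B}) (z0 : Z a0 b0) (i0 : 'I_k).
Variable V : finType.

Lemma pinvariantM (D : {set V}) F1 H1 F2 H2 : pinvariant (X := V) Z D F1 H1 -> pinvariant Z D F2 H2 ->
  pinvariant Z D (fun h => F1 h * F2 h) (fun h => H1 h * H2 h).
Proof. by move=> e1 e2 h h' z; rewrite (e1 _ _ z) (e2 _ _ z). Qed.

Lemma pinvariant_total (D : {set V}) F H : #|D| <= k -> pinvariant (X := V) Z D F H ->
  (forall (W : {set V}) (g h : {ffun V -> A}), [disjoint D & W] -> agree W h g -> F g = F h) /\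
  (forall (W : {set V}) (g h : {ffun V -> B}), [disjoint D & W] -> agree W h g -> H g = H h).
Proof.
move=> Dk FH; split=> W g h; first exact: (pinvariant_local bZ a0 i0 Dk FH).
have bZ' : pebble_bisim (fun b a => Z a b).
  split=> [b a z i j|b a z R t|b a z i G G' GG'||].
  - by rewrite (pb_eq bZ z).
  - by rewrite (pb_rel bZ z).
  - by apply/esym/(pb_sum bZ z) => a' b' /GG'.
  - exact: pb_totr bZ.
  - exact: pb_totl bZ.
apply: (pinvariant_local bZ' b0 i0 Dk (H := F)) => h1 h2 [m [b [a [z e]]]].
by apply/esym/FH; exists m, a, b; split=> // x /e [].
Qed.

(** The elements [W] private to the head bag occur in no other factor and are summed out. The result
    depends only on the intersection with later bags: it is constant if this is empty, and otherwise
    merges into the factor of the bag containing it. The overcount [N] is the same for [A] and [B]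
    and is cancelled. *)
Lemma sum_running_intersection (I : finType) (D : I -> {set V}) (r : seq I) F H :
  uniq r -> running_intersection (map D r) ->
  (forall v, v \in r -> #|D v| <= k /\ pinvariant Z (D v) (F v) (H v)) ->
  \sum_h \prod_(v <- r) F v h = \sum_h' \prod_(v <- r) H v h'.
Proof.
elim: r F H => [|v r IH] F H.
  move=> _ _ _; have eAB : #|A| = #|B|.
    by have := pb_sum bZ z0 i0 (F := fun _ => 1) (H := fun _ => 1) (fun _ _ _ => erefl);
      rewrite !sum1_card.
  under eq_bigr do rewrite big_nil; under [RHS]eq_bigr do rewrite big_nil.
  by rewrite !sum1_card !card_ffun eAB.
case/andP => vr ur /= [ripv ripr] FH; set U := \bigcup_(E <- map D r) E in ripv.
have [Dk FHv] := FH v (mem_head v r).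
have FHr w : w \in r -> #|D w| <= k /\ pinvariant Z (D w) (F w) (H w).
  by move=> wr; apply: FH; rewrite inE wr orbT.
pose W := D v :\: U.
have WD : W \subset D v by apply: subsetDl.
pose F1 h := \sum_(g | agree W h g) F v g.
pose H1 h' := \sum_(g | agree W h' g) H v g.
have FH1 : pinvariant Z (D v :&: U) F1 H1.
  by have := pinvariant_sum bZ WD Dk FHv; rewrite setDDr setDv set0U.
have Wk : #|W| <= k by apply: leq_trans Dk; apply: subset_leq_card.
have N1 h h' : \sum_(g : {ffun V -> A} | agree W h g) 1 = \sum_(g : {ffun V -> B} | agree W h' g) 1.
  have := @pinvariant_sum _ _ _ _ _ bZ _ W W (fun _ => 1) (fun _ => 1) (subxx _) Wk (fun _ _ _ => erefl).
  by apply; rewrite setDv; apply: (pebbled0 z0 i0).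
pose hA : {ffun V -> A} := [ffun => a0 i0]; pose hB : {ffun V -> B} := [ffun => b0 i0].
pose N := \sum_(g : {ffun V -> B} | agree W hB g) 1.
have N0 : 0 < N.
  rewrite /N (bigD1 hB) //; apply/forallP => y; by rewrite eqxx implybT.
have disj w : w \in r -> [disjoint D w & W].
  move=> wr; rewrite -setI_eq0; apply/eqP/setP => x; rewrite !inE.
  apply/negP => /andP [xw /andP [/negP xU _]]; apply: xU.
  by rewrite /U big_map bigcup_seq; apply/bigcupP; exists w.
have EA := @sum_eliminate V A W (F v) (fun h => \prod_(w <- r) F w h) N.
have EB := @sum_eliminate V B W (H v) (fun h => \prod_(w <- r) H w h) N.
under eq_bigr do rewrite big_cons; under [RHS]eq_bigr do rewrite big_cons.
apply/eqP; rewrite -(eqn_pmul2l N0) -EA; first last.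
- by move=> h; apply: N1.
- move=> g h hg; apply: eq_big_seq => w wr; have [wk FHw] := FHr w wr.
  exact: (pinvariant_total wk FHw).1 (disj w wr) hg.
rewrite -EB; first last.
- by move=> h; rewrite -(N1 hA h) (N1 hA hB).
- move=> g h hg; apply: eq_big_seq => w wr; have [wk FHw] := FHr w wr.
  exact: (pinvariant_total wk FHw).2 (disj w wr) hg.
apply/eqP; rewrite -/(F1 _); case: ripv => [D0|[_ /mapP [w wr ->] Dw]].
  rewrite D0 in FH1; pose c := F1 hA.
  have F1c h : F1 h = c by rewrite /c (FH1 h hB) ?(FH1 hA hB) //; apply: (pebbled0 z0 i0).
  have H1c h : H1 h = c by rewrite /c (FH1 hA h) //; apply: (pebbled0 z0 i0).
  under eq_bigr => h _ do rewrite -/(F1 h) F1c.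
  under [RHS]eq_bigr => h _ do rewrite -/(H1 h) H1c.
  by rewrite -!big_distrr /= (IH F H).
pose F2 x h := if x == w then F1 h * F x h else F x h.
pose H2 x h := if x == w then H1 h * H x h else H x h.
have e : \sum_h \prod_(x <- r) F2 x h = \sum_h \prod_(x <- r) H2 x h.
  apply: IH => // x xr; have [xk FHx] := FHr x xr; split=> //.
  rewrite /F2 /H2; case: eqP => [xw|//]; apply: pinvariantM => //.
  by rewrite xw => h h' /(pebbled_sub Dw); apply: FH1.
have E2 (T : finType) (G : I -> {ffun V -> T} -> nat) (G1 : {ffun V -> T} -> nat) h :
  \prod_(x <- r) (if x == w then G1 h * G x h else G x h) = G1 h * \prod_(x <- r) G x h.
  rewrite !(bigD1_seq w) //= eqxx mulnA; congr (_ * _ * _).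
  by apply: eq_bigr => x /negbTE ->.
transitivity (\sum_h \prod_(x <- r) F2 x h); first by apply: eq_bigr => h _; rewrite E2.
by rewrite e; apply: eq_bigr => h _; rewrite E2.
Qed.

End FactorElimination.

Section TreewidthHom.
Variables (s : sign) (k : nat) (A B : struct s).

Lemma pebble_equiv_hom : (forall R : s, 0 < ar R) -> 0 < k -> pebble_equiv k A B ->
  forall X : struct s, treewidth_lt X k -> homcount X A = homcount X B.
Proof.
move=> ar0 k0 eAB X [n [E [b [[treeE cov conn] wd]]]].
have bk v : #|b v| <= k.
  have : \max_(v < n) #|b v| <= k by move: wd; rewrite /width; lia.
  by apply: leq_trans; apply: leq_bigmax.
have [r [ur rv rr]] := tree_order treeE conn.
(* The factor of a node tests the constraints that fit in its bag. A constraint may be tested at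
   several nodes, harmlessly, as factors are 0 or 1. *)
pose F (T : struct s) v (h : {ffun X -> T}) : nat :=
  [forall R, forall t in rrel X R, ([set x in t] \subset b v) ==> (map_tuple h t \in rrel T R)].
have homE (T : struct s) : homcount X T = \sum_(h : {ffun X -> T}) \prod_(v <- r) F T v h.
  rewrite /homcount -sum1_card big_mkcond /=; apply: eq_bigr => h _; rewrite inE.
  have [hh|hh] := boolP (is_hom h).
    rewrite big1_seq // => v _; apply/eqP; rewrite eqb1.
    apply/forallP => R; apply/forall_inP => t tR; apply/implyP => _.
    by have /forallP /(_ R) /forall_inP /(_ t tR) := hh.
  move: hh => /forallPn [R] /forall_inPn [t tR tT].
  have [v vt] := cov R t tR; apply/esym/eqP; rewrite prod_nat_seq_eq0.
  apply/hasP; exists v; first exact: rv.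
  rewrite eqb0; apply/negP => /forallP /(_ R) /forall_inP /(_ t tR).
  by rewrite vt (negbTE tT).
(* An empty [A] offers no placement to start from. Then [B] is empty too, and both counts are 1 for
   empty [X] and 0 otherwise. *)
have [A0|/card_gt0P [a _]] := posnP #|A|.
  have B0 := (pebble_equiv_empty eAB k0).1 A0.
  have [X0|/card_gt0P [x _]] := posnP #|X|.
    have hom1 (T : struct s) : homcount X T = 1.
      rewrite /homcount -[RHS](expn0 #|T|) -X0 -card_ffun -cardsT; apply: eq_card => h.
      rewrite !inE; apply/forallP => R; apply/forall_inP => t _.
      by have := fintype0 (tnth t (Ordinal (ar0 R))) X0.
    by rewrite !hom1.
  have hom0 (T : struct s) : #|T| = 0 -> homcount X T = 0.
    move=> T0; apply/eqP; rewrite cards_eq0; apply/eqP/setP => h.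
    by have := fintype0 (h x) T0.
  by rewrite !hom0.
case: eAB => Z bZ; have [b0 z0] := pb_totl bZ [ffun=> a].
rewrite !homE; apply: (sum_running_intersection bZ z0 (Ordinal k0) ur rr) => v _; split=> // h h' z.
congr nat_of_bool; apply: eq_forallb => R; apply: eq_forallb => t.
have [tb|] := boolP ([set x in t] \subset b v); last by rewrite !implybT.
by rewrite (pebbled_rel bZ z tb).
Qed.
End TreewidthHom.

(** * Forests of k-tuples presenting structures with a distinguished tuple *)

Section System.
Variables (s : sign) (k : nat).

(* A forest of nodes over a virtual root [None]; every node carries a [k]-tuple
   of values that agrees with the parent's tuple on the positions in [lnk]. *)
Record sys := Sys {
  node : finType;
  par : node -> option node;
  rk : node -> nat;
  lnk : node -> {set 'I_k};
  ratoms : node -> forall R : s, {set (ar R).-tuple 'I_k};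
  eatoms : node -> rel 'I_k;
  par_rk : forall p q, par p = Some q -> rk q < rk p }.

Section Eval.
Variable T : struct s.
Implicit Types (S : sys) (a : {ffun 'I_k -> T}).

Definition at_node (I : Type) a (fam : I -> {ffun 'I_k -> T}) (o : option I) :=
  if o is Some p then fam p else a.

Definition ok_at a (L : {set 'I_k}) (P : forall R : s, {set (ar R).-tuple 'I_k}) (Q : rel 'I_k)
    (c : {ffun 'I_k -> T}) :=
  [&& [forall i in L, c i == a i], [forall R, forall t in P R, map_tuple c t \in rrel T R] &
      [forall i, forall j, Q i j ==> (c i == c j)]].

Definition ok S a (fam : {ffun node S -> {ffun 'I_k -> T}}) :=
  [forall p, ok_at (at_node a fam (par p)) (lnk p) (ratoms p) (@eatoms S p) (fam p)].

Arguments ok S a fam : clear implicits.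

(** The number of homomorphisms from the presented structure that send the root tuple to [a],
    obtained without forming that structure. *)
Definition ev S a : nat := \sum_(fam : {ffun node S -> {ffun 'I_k -> T}}) (ok S a fam : nat).
End Eval.
Arguments ok {T} S a fam.

Definition sys_one : sys := @Sys void (fun p => match p with end) (fun p => match p with end)
  (fun p => match p with end) (fun p => match p with end) (fun p => match p with end)
  (fun p => match p with end).

(** The virtual root carries no atoms, so an atom about it sits on a child linked to it at every
    position. *)
Definition sys_atom P Q : sys := @Sys unit (fun _ => None) (fun _ => 0)
  (fun _ => setT) (fun _ => P) (fun _ => Q) (fun p q e => match notF (congr1 isSome e) with end).

Definition mul_par (S1 S2 : sys) (p : node S1 + node S2) : option (node S1 + node S2)%type :=
  match p with inl p => omap inl (par p) | inr p => omap inr (par p) end.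
Definition mul_rk (S1 S2 : sys) (p : node S1 + node S2) : nat :=
  match p with inl p => rk p | inr p => rk p end.
Lemma mul_par_rk S1 S2 (p q : node S1 + node S2) : mul_par p = Some q -> mul_rk q < mul_rk p.
Proof. by case: p => p /=; case e : (par p) => [r|] //= [<-]; apply: par_rk. Qed.

(** Two forests that share only the virtual root have independent solutions. *)
Definition sys_mul (S1 S2 : sys) : sys := @Sys (node S1 + node S2)%type (@mul_par S1 S2)
  (@mul_rk S1 S2)
  (fun p => match p with inl p => lnk p | inr p => lnk p end)
  (fun p => match p with inl p => ratoms p | inr p => ratoms p end)
  (fun p => match p with inl p => @eatoms S1 p | inr p => @eatoms S2 p end)
  (@mul_par_rk S1 S2).

Definition sum_par (S : sys) (p : option (node S)) : option (option (node S)) :=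
  omap (@par S) p.
Definition sum_rk (S : sys) (p : option (node S)) : nat := if p is Some p then (rk p).+1 else 0.
Lemma sum_par_rk S (p q : option (node S)) : sum_par p = Some q -> sum_rk q < sum_rk p.
Proof. by case: p => //= p [<-]; case e : (par p) => [r|] //=; rewrite ltnS; apply: par_rk. Qed.

(** The old root becomes the node [None], linked to the new root except at [i]; its free entry is
    the summation variable. *)
Definition sys_sum (i : 'I_k) (S : sys) : sys := @Sys (option (node S)) (@sum_par S) (@sum_rk S)
  (fun p => if p is Some p then lnk p else [set~ i])
  (fun p => if p is Some p then ratoms p else fun _ => set0)
  (fun p => if p is Some p then @eatoms S p else fun _ _ => false)
  (@sum_par_rk S).

Lemma ok_at_trivial (T : struct s) (a c : {ffun 'I_k -> T}) L :
  ok_at a L (fun _ => set0) (fun _ _ => false) c = [forall i in L, c i == a i].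
Proof.
rewrite /ok_at; set b := [forall i in L, _]; rewrite andb_idr // => _; apply/andP; split.
  by apply/forallP => R; apply/forallP => t; rewrite inE.
by apply/forallP => i; apply/forallP.
Qed.

Lemma ev_one (T : struct s) a : ev (T := T) sys_one a = 1.
Proof.
pose f0 : {ffun node sys_one -> {ffun 'I_k -> T}} := [ffun p : void => match p with end].
rewrite /ev (big_pred1 f0) => [|f].
  by apply/eqP; rewrite eqb1; apply/forallP => -[].
by apply/esym/eqP/ffunP => -[].
Qed.

Lemma ev_atom (T : struct s) (a : {ffun 'I_k -> T}) P Q : ev (sys_atom P Q) a = ok_at a set0 P Q a.
Proof.
rewrite /ev (bigD1 [ffun => a]) //= big1 => [|f fa].
  rewrite addn0; congr nat_of_bool; apply/forallP/idP => [/(_ tt)|] h.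
    by move: h; rewrite ffunE /ok_at => /andP [_ h]; rewrite h andbT; apply/forallP => i; rewrite inE.
  case; rewrite ffunE /= /ok_at; case/andP: h => _ ->; rewrite andbT.
  by apply/forallP => i; rewrite eqxx implybT.
apply/eqP; rewrite eqb0; apply: contraNN fa => /forallP /(_ tt) /andP [/forallP h _].
apply/eqP/ffunP => -[]; rewrite ffunE; apply/ffunP => i; apply/eqP.
by have := h i; rewrite inE.
Qed.

Lemma ev_mul (T : struct s) (a : {ffun 'I_k -> T}) S1 S2 : ev (sys_mul S1 S2) a = ev S1 a * ev S2 a.
Proof.
pose pack (f : {ffun node S1 -> {ffun 'I_k -> T}} * {ffun node S2 -> {ffun 'I_k -> T}}) :
  {ffun node (sys_mul S1 S2) -> {ffun 'I_k -> T}} :=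
  [ffun p => match p with inl p => f.1 p | inr p => f.2 p end].
rewrite /ev big_distrlr pair_bigA /= (reindex pack) /=; last first.
  exists (fun f => ([ffun p => f (inl p)], [ffun p => f (inr p)])) => [[f g]|f] _.
    by congr (_, _); apply/ffunP => p; rewrite !ffunE.
  by apply/ffunP => -[p|p]; rewrite !ffunE.
apply: eq_bigr => -[f g] _ /=; rewrite mulnb; congr nat_of_bool.
have e1 p : at_node a (pack (f, g)) (omap inl p) = at_node a f p by case: p => //= p; rewrite ffunE.
have e2 p : at_node a (pack (f, g)) (omap inr p) = at_node a g p by case: p => //= p; rewrite ffunE.
apply/forallP/andP => [h|[/forallP h1 /forallP h2] [p|p]].
- split; apply/forallP => p.
    by have := h (inl p); rewrite /= e1 ffunE.
  by have := h (inr p); rewrite /= e2 ffunE.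
- by rewrite /= e1 ffunE.
by rewrite /= e2 ffunE.
Qed.

Lemma ev_sum (T : struct s) (a : {ffun 'I_k -> T}) i S : ev (sys_sum i S) a = \sum_c ev S (upd a i c).
Proof.
pose pack (f : {ffun 'I_k -> T} * {ffun node S -> {ffun 'I_k -> T}}) :
  {ffun node (sys_sum i S) -> {ffun 'I_k -> T}} :=
  [ffun p => if p is Some p then f.2 p else f.1].
rewrite /ev (reindex pack) /=; last first.
  exists (fun f => (f None, [ffun p => f (Some p)])) => [[d f]|f] _.
    by congr (_, _); [|apply/ffunP => p]; rewrite !ffunE.
  by apply/ffunP => -[p|]; rewrite !ffunE.
rewrite -(pair_bigA _ (fun d f => nat_of_bool (ok (sys_sum i S) a (pack (d, f))))) /=.
have okE d f : ok (sys_sum i S) a (pack (d, f)) = [forall j in [set~ i], d j == a j] && ok S d f.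
  have e1 (p : option (node S)) : at_node a (pack (d, f)) (Some p) = at_node d f p.
    by rewrite /= ffunE; case: p.
  apply/forallP/andP => [h|[h1 /forallP h2] [p|]].
  - split; first by have := h None; rewrite /= ok_at_trivial ffunE.
    by apply/forallP => p; have := h (Some p); rewrite e1 ffunE.
  - by rewrite e1 ffunE.
  by rewrite /= ok_at_trivial ffunE.
under eq_bigr => d _ do under eq_bigr => f _ do rewrite okE -mulnb.
under eq_bigr => d _ do rewrite -big_distrr /=.
under eq_bigr => d _ do rewrite mulnbl.
rewrite -big_mkcond /=.
rewrite (reindex_onto (upd a i) (fun d => d i)) /=.
  apply: eq_bigl => c; rewrite ffunE eqxx eqxx andbT.
  by apply/forall_inP => j; rewrite !inE ffunE => /negbTE ->.
move=> d /forall_inP h; apply/ffunP => j; rewrite ffunE; case: eqP => [->//|/eqP ji].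
by apply/esym/eqP/h; rewrite !inE.
Qed.

End System.
Arguments ok {s k T} S a fam.

(** * The tree of a parent function with decreasing rank *)

Section ParentTree.
Variables (I : finType) (par : I -> option I) (rk : I -> nat).
Hypothesis par_rk : forall p q, par p = Some q -> rk q < rk p.

Definition tedge (x y : option I) : bool :=
  match x with Some p => par p == y | None => false end ||
  match y with Some p => par p == x | None => false end.

Let rko (x : option I) : nat := if x is Some p then (rk p).+1 else 0.

Lemma tedge_sym : symmetric tedge.
Proof. by move=> x y; rewrite /tedge orbC. Qed.

Lemma par_rko p : rko (par p) < rko (Some p).
Proof. by case e : (par p) => [q|] //=; rewrite ltnS; apply: par_rk. Qed.

Lemma tedge_irr : irreflexive tedge.
Proof.
case=> [p|] //=; rewrite /tedge orbb; apply/negP => /eqP e.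
by have := par_rko p; rewrite e ltnn.
Qed.

Lemma tedge_up x y : tedge x y -> rko y <= rko x -> exists2 p, x = Some p & y = par p.
Proof.
case/orP; first by case: x => // p /eqP <- _; exists p.
by case: y => // p /eqP <-; rewrite leqNgt par_rko.
Qed.

Lemma tedge_root x : connect tedge x None.
Proof.
have [m] := ubnP (rko x); elim: m x => // m IH [p|] h; last exact: connect0.
apply: (connect_trans (connect1 _)) (IH (par p) _); first by rewrite /tedge eqxx.
exact: leq_trans (par_rko p) h.
Qed.

(* Both neighbours of a node of largest rank on a cycle would be its parent. *)
Lemma tedge_acyclic x p : 2 <= size p -> uniq (x :: p) -> ~~ path.cycle tedge (x :: p).
Proof.
move=> p2 up; apply/negP => cyc.
have [m mp mmax] : exists2 m, m \in x :: p & forall y, y \in x :: p -> rko y <= rko m.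
  have h : x \in x :: p by rewrite mem_head.
  by case: (@arg_maxnP _ x (mem (x :: p)) rko h) => m mp mm; exists m.
have [i q rotE] := rot_to mp; have := cyc; rewrite -(rot_cycle i) rotE.
have uq : uniq (m :: q) by rewrite -rotE rot_uniq.
have memq y : y \in q -> rko y <= rko m.
  by move=> yq; apply: mmax; rewrite -(mem_rot i) rotE inE yq orbT.
have : size (m :: q) = size (x :: p) by rewrite -rotE size_rot.
case: q uq memq {rotE} => [|y q] uq memq /=; first by case=> e; rewrite -e in p2.
case=> e; rewrite rcons_path => /and3P [my _ lm].
have [r mr ym] := tedge_up my (memq _ (mem_head _ _)).
have [r' mr' lm'] : exists2 r', m = Some r' & last y q = par r'.
  by apply: tedge_up; [rewrite tedge_sym|apply: memq; rewrite mem_last].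
move: uq; rewrite /= => /and3P [_ yq _]; case/negP: yq.
have <- : last y q = y by rewrite lm' ym; congr par; move: mr'; rewrite mr => -[].
by case: q e {lm lm' memq} => [|z q] e; [rewrite -e in p2|rewrite /= mem_last].
Qed.

Let n := #|{: option I}|.
Definition tedge_ord : rel 'I_n := fun u v => tedge (enum_val u) (enum_val v).

(** [P] is constantly true when the whole tree is shown connected, and membership in a bag when the
    nodes holding a given element are. *)
Lemma connect_tedge_ord (P : option I -> bool) x y :
  connect (fun p q => [&& tedge p q, P p & P q]) x y ->
  connect (fun p q => [&& tedge_ord p q, P (enum_val p) & P (enum_val q)])
    (enum_rank x) (enum_rank y).
Proof.
case/connectP => p ep ->; elim: p x ep => [|z p IH] x /=; first by rewrite connect0.
move=> /andP [xz zp]; apply: connect_trans (IH _ zp); apply: connect1.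
by rewrite /tedge_ord !enum_rankK.
Qed.

Lemma tedge_ord_tree : is_tree tedge_ord.
Proof.
split.
- by apply/card_gt0P; exists None.
- by move=> u v; apply: tedge_sym.
- by move=> u; apply: tedge_irr.
- have root u : connect tedge_ord u (enum_rank None).
    have /connectP [p ep lp] := tedge_root (enum_val u).
    have : connect (fun p q => [&& tedge p q, xpredT p & xpredT q]) (enum_val u) None.
      by apply/connectP; exists p => //; apply: sub_path ep => c d ->.
    move/connect_tedge_ord; rewrite enum_valK; apply: connect_sub => c d /andP [cd _].
    exact: connect1.
  move=> u v; apply: connect_trans (root u) _.
  by rewrite sym_connect_sym // => c d; apply: tedge_sym.
case=> x [p [p2 up pp lp]].
have /(_ _ _)/negP := @tedge_acyclic (enum_val x) (map enum_val p).
rewrite size_map -map_cons map_inj_uniq; last exact: enum_val_inj.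
move=> /(_ p2 up); apply; rewrite /= -map_rcons path_map rcons_path.
by rewrite (eq_path (e' := tedge_ord)) // pp.
Qed.
End ParentTree.

(** * The structure presented by a forest *)

Section Realize.
Variables (s : sign) (k : nat) (S : sys s k).

Let V : finType := (option (node S) * 'I_k)%type.

Definition glue (x y : V) : bool :=
  match x.1 with
  | Some p => ((y.1 == par p) && (x.2 == y.2) && (x.2 \in lnk p)) ||
              ((y.1 == Some p) && eatoms p x.2 y.2)
  | None => false
  end.
Definition glue_sym : rel V := fun x y => glue x y || glue y x.

Lemma connect_glue_sym : connect_sym glue_sym.
Proof. by apply: sym_connect_sym => x y; rewrite /glue_sym orbC. Qed.

(** The quotient of the variables by the identifications, each class represented by the root of its
    component. *)
Definition glued : finType := {x : V | roots glue_sym x}.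
Definition cls (x : V) : glued := exist _ (fingraph.root glue_sym x) (roots_root connect_glue_sym x).

Lemma cls_val (u : glued) : cls (val u) = u.
Proof. by apply: val_inj; rewrite /=; apply/eqP; apply: (valP u). Qed.

Lemma cls_eq x y : reflect (cls x = cls y) (connect glue_sym x y).
Proof.
apply: (iffP (fingraph.rootP connect_glue_sym)) => [e|/(congr1 val)//]; exact: val_inj.
Qed.

Definition realize : struct s := @Struct s glued (fun R =>
  [set tt | [exists p : node S, exists t in ratoms p R,
     tt == map_tuple (fun i => cls (Some p, i)) t]]).

Section Hom.
Variable T : struct s.
Notation fam := {ffun node S -> {ffun 'I_k -> T}}.

Let at_var (a : {ffun 'I_k -> T}) (f : fam) (x : V) : T := at_node a f x.1 x.2.

Lemma ok_glue a (f : fam) x y : ok S a f -> connect glue_sym x y -> at_var a f x = at_var a f y.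
Proof.
move=> /forallP okf; have gl u v : glue u v -> at_var a f u = at_var a f v.
  case: u v => [[p|] i] [q j] //=; have /and3P [/forall_inP h1 _ /forallP h2] := okf p.
  case/orP => [/andP [/andP [/eqP /= -> /eqP <-] il]|/andP [/eqP /= -> e]].
    by apply/eqP/h1.
  by apply/eqP; have /forallP /(_ j) := h2 i; rewrite e.
case/connectP => p ep ->; elim: p x ep => [//|z p IH] x /= /andP [xz zp].
by rewrite -IH //; case/orP: xz => /gl.
Qed.

(** [phi] reads the values of a homomorphism at all variables. Conversely an admissible assignment
    is constant on classes by [ok_glue], so it descends to the quotient. *)
Lemma homcount_realize : homcount realize T = \sum_a ev (T := T) S a.
Proof.
rewrite /ev pair_bigA /=.
pose phi (h : {ffun realize -> T}) : {ffun 'I_k -> T} * fam :=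
  ([ffun i => h (cls (None, i))], [ffun p => [ffun i => h (cls (Some p, i))]]).
have phiE h x : at_var (phi h).1 (phi h).2 x = h (cls x).
  by case: x => [[p|] i]; rewrite /at_var /= !ffunE.
have phi_inj : injective phi.
  by move=> g h e; apply/ffunP => u; rewrite -(cls_val u) -!phiE e.
have -> : \sum_(p : {ffun 'I_k -> T} * fam) (ok S p.1 p.2 : nat) =
    #|[set p : {ffun 'I_k -> T} * fam | ok S p.1 p.2]|.
  by rewrite -sum1_card [RHS]big_mkcond /=; apply: eq_bigr => p _; rewrite inE; case: ok.
rewrite /homcount -(card_imset _ phi_inj); congr #|pred_of_set _|; apply/setP => -[a f].
rewrite inE /=; apply/imsetP/idP => [[h]|okf].
  rewrite inE => /forallP hh e; have [ea ef] : a = (phi h).1 /\ f = (phi h).2 by rewrite -e.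
  have vE x : at_var a f x = h (cls x) by rewrite ea ef phiE.
  apply/forallP => p; apply/and3P; split.
  - apply/forall_inP => i il; have := vE (Some p, i); rewrite /at_var /= => ->.
    have := vE (par p, i); rewrite /at_var /= => ->; apply/eqP; congr (h _).
    by apply/cls_eq/connect1; rewrite /glue_sym /glue /= !eqxx il.
  - apply/forallP => R; apply/forall_inP => t tR.
    have -> : map_tuple (f p) t = map_tuple h (map_tuple (fun i => cls (Some p, i)) t).
      by apply: eq_from_tnth => i; rewrite !tnth_map -vE.
    have /forall_inP := hh R; apply; rewrite inE.
    by apply/existsP; exists p; apply/existsP; exists t; rewrite tR eqxx.
  - apply/forallP => i; apply/forallP => j; apply/implyP => e1.
    have := vE (Some p, i); have := vE (Some p, j); rewrite /at_var /= => -> ->.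
    apply/eqP; congr (h _); apply/cls_eq/connect1.
    by rewrite /glue_sym /glue /= eqxx e1 orbT.
pose h : {ffun realize -> T} := [ffun u : glued => at_var a f (val u)].
have hE x : h (cls x) = at_var a f x.
  rewrite ffunE; apply: (ok_glue okf); rewrite connect_glue_sym; exact: connect_root.
exists h; last first.
  congr (_, _); apply/ffunP => p; first by rewrite ffunE hE.
  by apply/ffunP => i; rewrite 2!ffunE hE.
rewrite inE; apply/forallP => R; apply/forall_inP => tt.
rewrite inE => /existsP [p /existsP [t /andP [tR /eqP ->]]].
have -> : map_tuple h (map_tuple (fun i => cls (Some p, i)) t) = map_tuple (f p) t.
  by apply: eq_from_tnth => i; rewrite !tnth_map hE.
have /forallP /(_ p) /and3P [_ /forallP /(_ R) /forall_inP h1 _] := okf.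
exact: h1.
Qed.
End Hom.

Definition bag (o : option (node S)) : {set realize} := [set cls (o, i) | i : 'I_k].

(** A bag holds the classes of the [k] variables of one node. Two variables of the same class are
    joined by a chain of gluings inside that class, and each gluing stays at a node or crosses an
    edge of the tree. *)
Lemma treewidth_realize : treewidth_lt realize k.
Proof.
exists #|{: option (node S)}|, (tedge_ord (@par _ _ S)), (fun v => bag (enum_val v)); split; last first.
  rewrite /width; set M := \max_(_ < _) _; suff : M <= k by lia.
  apply/bigmax_leqP => v _; apply: leq_trans (leq_imset_card _ _) _; by rewrite card_ord.
split.
- exact: (tedge_ord_tree (@par_rk _ _ S)).
- move=> R tt; rewrite inE => /existsP [p /existsP [t /andP [tR /eqP ->]]].
  exists (enum_rank (Some p)); rewrite enum_rankK; apply/subsetP => x; rewrite inE.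
  by case/mapP => i _ ->; apply: imset_f.
move=> x u v /imsetP [i _ xi] /imsetP [j _ xj].
rewrite -(enum_valK u) -(enum_valK v).
apply: (@connect_tedge_ord _ _ (fun o => x \in bag o)).
have /connectP [p ep lp] : connect glue_sym (enum_val u, i) (enum_val v, j).
  by apply/cls_eq; rewrite -xi.
have inbag y : x = cls y -> x \in bag y.1 by case: y => o l ->; apply: imset_f.
elim: p (enum_val u) i xi ep lp => [|[o l] p IH] w i xi /=; first by move=> _ [<- _]; exact: connect0.
case/andP => g ep lp; have xl : x = cls (o, l) by rewrite xi; apply/cls_eq/connect1.
apply: connect_trans (IH o l xl ep lp); have xw := inbag _ xi; have xo := inbag _ xl.
have [<-|wo] := eqVneq w o; first exact: connect0.
apply: connect1; rewrite xw xo !andbT /tedge; case/orP: g; rewrite /glue /=.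
  case: w wo {xi xw} => // q wo /orP [/andP [/andP [/eqP -> _] _]|/andP [/eqP e _]]; first by rewrite eqxx.
  by rewrite e eqxx in wo.
case: o wo {IH lp ep xl xo} => // q wo /orP [/andP [/andP [/eqP -> _] _]|/andP [/eqP e _]]; first by rewrite eqxx orbT.
by rewrite e eqxx in wo.
Qed.

End Realize.

Section HomPebble.
Variables (s : sign) (k : nat) (A B : struct s).

Lemma hom_pebble_equiv : 0 < k ->
  (forall X : struct s, treewidth_lt X k -> homcount X A = homcount X B) ->
  pebble_equiv k A B.
Proof.
move=> k0 hAB.
have evAB (S : sys s k) : \sum_a ev (T := A) S a = \sum_b ev (T := B) S b.
  by rewrite -!homcount_realize; apply/hAB/treewidth_realize.
exists (fun a b => forall S : sys s k, ev S a = ev S b); split.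
- move=> a b z i j; have := z (sys_atom (fun _ => set0) (fun l m => (l == i) && (m == j))).
  have eE (T : struct s) (c : {ffun 'I_k -> T}) :
    ok_at c set0 (fun _ => set0) (fun l m => (l == i) && (m == j)) c = (c i == c j).
    apply/and3P/idP => [[_ _ /forallP /(_ i) /forallP /(_ j)]|e]; first by rewrite !eqxx.
    split; first by apply/forallP => l; rewrite inE.
      by apply/forallP => R; apply/forallP => t; rewrite inE.
    by apply/forallP => l; apply/forallP => m; apply/implyP => /andP [/eqP-> /eqP->].
  by rewrite !ev_atom !eE; do 2 case: (_ == _).
(* [P] is [t] alone at [R] and empty at other symbols; comparing tagged tuples avoids a cast between
   arities. *)
- move=> a b z R t; pose P R' := [set t' : (ar R').-tuple 'I_k |
    Tagged (fun R => (ar R).-tuple 'I_k) t' == Tagged _ t].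
  have := z (sys_atom P (fun _ _ => false)).
  have eE (T : struct s) (c : {ffun 'I_k -> T}) :
    ok_at c set0 P (fun _ _ => false) c = (map_tuple c t \in rrel T R).
    apply/and3P/idP => [[_ /forallP /(_ R) /forall_inP /(_ t) h _]|e]; first by apply: h; rewrite inE.
    split; first by apply/forallP => l; rewrite inE.
      apply/forallP => R'; apply/forall_inP => t'; rewrite inE => /eqP e'.
      by have /= -> := congr1 (fun u : {R : s & (ar R).-tuple 'I_k} =>
        map_tuple c (tagged u) \in rrel T (tag u)) e'.
    by apply/forallP => l; apply/forallP.
  by rewrite !ev_atom !eE; do 2 case: (_ \in _).
- move=> a b z i F H FH.
  apply: (@separated_sum A B (sys s k) (fun S c => ev S (upd a i c))
    (fun S c => ev S (upd b i c)) (sys_one s k) (@sys_mul s k)).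
  + by move=> c; rewrite ev_one.
  + by move=> c; rewrite ev_one.
  + by move=> S1 S2 c; rewrite ev_mul.
  + by move=> S1 S2 c; rewrite ev_mul.
  + by move=> S; rewrite -!ev_sum z.
  + by move=> c d e; apply: FH => S; rewrite e.
- exact: (separated_partner (@ev_one s k A) (@ev_one s k B)
    (fun S1 S2 a => ev_mul a S1 S2) (fun S1 S2 b => ev_mul b S1 S2) evAB).
move=> b; have [a e] := separated_partner (@ev_one s k B) (@ev_one s k A)
    (fun S1 S2 b => ev_mul b S1 S2) (fun S1 S2 a => ev_mul a S1 S2) (fun S => esym (evAB S)) b.
by exists a => S; rewrite e.
Qed.

End HomPebble.

(** * Colour refinement *)

Lemma sum_sig (T : finType) (P : pred T) (F : T -> nat) :
  \sum_(x : {x | P x}) F (val x) = \sum_(x | P x) F x.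
Proof.
rewrite [RHS](reindex_omap (val : {x | P x} -> T) insub) /=; last first.
  by move=> x Px; rewrite insubT.
by apply/esym/eq_bigl => x; rewrite valK eqxx andbT; apply: valP.
Qed.

Lemma sum_sigT (I : finType) (J : I -> finType) (P : pred {i : I & J i}) (F : {i : I & J i} -> nat) :
  \sum_(p | P p) F p = \sum_i \sum_(j : J i | P (Tagged J j)) F (Tagged J j).
Proof.
rewrite (@sig_big_dep _ _ _ I J predT (fun i j => P (Tagged J j)) (fun i j => F (Tagged J j))) /=.
by apply: eq_big => [[i j]|[i j] _].
Qed.

Lemma sum_cons (s : sign) (A : struct s) (Q : pred (cons A)) (G : cons A -> nat) :
  \sum_(c | isC c && Q c) G c =
  \sum_(R : s) \sum_(t in rrel A R | Q (Tagged (fun R => (ar R).-tuple A) t))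
    G (Tagged (fun R => (ar R).-tuple A) t).
Proof. by rewrite sum_sigT. Qed.

Notation mkc A t := (Tagged (fun R => (ar R).-tuple (univ A)) t).

Lemma sum_cons_tag (s : sign) (A : struct s) R (Q : pred (cons A)) (G : cons A -> nat) :
  (forall R' (t : (ar R').-tuple A), R' != R -> G (mkc A t) = 0) ->
  \sum_(c | isC c && Q c) G c = \sum_(t in rrel A R | Q (mkc A t)) G (mkc A t).
Proof.
move=> G0; rewrite sum_cons (bigD1 R) //= [X in _ + X]big1 ?addn0 // => R' nR.
by apply: big1 => t _; apply: G0.
Qed.

(** * Invariant relations for colour refinement *)

Section EltBisim.
Variables (s : sign) (A B : struct s).

Definition tuple_rel (ze : A -> B -> Prop) n (t : n.-tuple A) (t' : n.-tuple B) :=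
  (forall i j, (tnth t i == tnth t j) = (tnth t' i == tnth t' j)) /\
  (forall i, ze (tnth t i) (tnth t' i)).

(** The analogue of [pebble_bisim] for single elements. [eb_edge] fixes one position of a constraint
    rather than a whole edge label; the label is recovered from the equality pattern in
    [tuple_rel]. *)
Record elt_bisim (ze : A -> B -> Prop) : Prop := EltBisim {
  eb_edge : forall a b, ze a b -> forall (R : s) (i : 'I_(ar R)) F H,
    (forall t t', t \in rrel A R -> t' \in rrel B R -> tuple_rel ze t t' -> F t = H t') ->
    \sum_(t in rrel A R | tnth t i == a) F t = \sum_(t in rrel B R | tnth t i == b) H t :> nat;
  eb_total : forall F H, (forall a b, ze a b -> F a = H b) ->
    \sum_a F a = \sum_b H b :> nat }.
End EltBisim.

Section FirstOcc.
Variables (T : finType) (n : nat) (t : n.-tuple T).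

(** One position per distinct entry, chosen by the equality pattern alone, so that tuples of the
    same pattern share this index set. *)
Definition first_occ := [set i : 'I_n | [forall j, (tnth t j == tnth t i) ==> (i <= j)]].

Lemma sum_mem_tuple (G : T -> nat) :
  \sum_(a | a \in t) G a = \sum_(i in first_occ) G (tnth t i).
Proof.
rewrite -(big_imset (h := tnth t) G) /=; last first.
  move=> i j; rewrite !inE => /forallP hi /forallP hj e; apply/val_inj/eqP => /=.
  by rewrite eqn_leq (implyP (hi j)) ?e // (implyP (hj i)) // e.
apply: eq_bigl => a; apply/idP/imsetP => [/tnthP [i ->]|[i _ ->]]; last exact: mem_tnth.
case: (@arg_minnP _ i (fun j => tnth t j == tnth t i) (@nat_of_ord n) (eqxx _)) => j /eqP ji jmin.
exists j => //; rewrite inE; apply/forallP => l; apply/implyP; rewrite ji; exact: jmin.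
Qed.
End FirstOcc.

(** * Colour refinement and invariant relations on elements *)

Section Equiv1.
Variables (s : sign) (A B : struct s).
Hypothesis ar0 : forall R : s, 0 < ar R.

Lemma label_eq (C : struct s) (c : C) R (t : (ar R).-tuple C) S :
  (label c (mkc C t) == Tagged _ S) = ([set i | tnth t i == c] == S).
Proof. by rewrite /label -tag_eqE /tag_eq /= eqxx tagged_asE. Qed.

Lemma label_neq (C : struct s) (c : C) R R' (t : (ar R').-tuple C) (S : {set 'I_(ar R)}) :
  R' != R -> (label c (mkc C t) == Tagged (fun R => {set 'I_(ar R)}) S) = false.
Proof. by move=> nR; apply: contraNF nR => /eqP /(congr1 (@tag _ _)) /= ->. Qed.

(* Fixing a position in the label singles out the summation in [eb_edge]. *)
Lemma sum_label (C : struct s) (c : C) R (S : {set 'I_(ar R)}) i (D : eqType) (d : cons C -> D) x :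
  i \in S ->
  \sum_(t | isC t && (c \in tagged t)) ((label c t, d t) == (Tagged (fun R => {set 'I_(ar R)}) S, x) : nat) =
  \sum_(t in rrel C R | tnth t i == c)
     (([set l | tnth t l == tnth t i] == S) && (d (mkc C t) == x) : nat).
Proof.
move=> iS; rewrite (@sum_cons_tag _ _ R (fun t : cons C => c \in tagged t)) => [|R' t nR]; last first.
  by rewrite xpair_eqE label_neq.
rewrite [LHS]big_mkcondr [RHS]big_mkcondr /=; apply: eq_bigr => t _.
rewrite xpair_eqE label_eq.
case: (eqVneq (tnth t i) c) => [<-|ic]; first by rewrite mem_tnth.
case: (c \in t) => //; case: eqP => // /setP /(_ i); rewrite !inE iS.
by rewrite (negbTE ic).
Qed.

Lemma sum_label0 (C : struct s) (c : C) R (D : eqType) (d : cons C -> D) x :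
  \sum_(t | isC t && (c \in tagged t)) ((label c t, d t) ==
    (Tagged (fun R => {set 'I_(ar R)}) (set0 : {set 'I_(ar R)}), x) : nat) = 0.
Proof.
rewrite big1 // => -[R' t] /andP [_ /tnthP [i /= ->]]; apply/eqP; rewrite eqb0 xpair_eqE negb_and.
apply/orP; left; apply/eqP => /(congr1 (fun u : lab s => #|tagged u|)) /eqP.
by rewrite /= cards0 cards_eq0 => /eqP /setP /(_ i); rewrite !inE eqxx.
Qed.

Lemma edge_multiset (ze : A -> B -> Prop) a b (D : eqType) (dA : cons A -> D) (dB : cons B -> D) :
  elt_bisim ze -> ze a b ->
  (forall R (t : (ar R).-tuple A) (t' : (ar R).-tuple B), tuple_rel ze t t' ->
     dA (mkc A t) = dB (mkc B t')) ->
  perm_eq [seq (label a c, dA c) | c <- enum {: cons A} & isC c && (a \in tagged c)]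
          [seq (label b c, dB c) | c <- enum {: cons B} & isC c && (b \in tagged c)].
Proof.
move=> bze zab dAB; apply/perm_map_sum => -[[R S] x].
rewrite !big_filter !big_enum_cond.
(* No edge has an empty label; otherwise a position in [S] is what [eb_edge] asks for. *)
have [->|[i iS]] := set_0Vmem S; first by rewrite !sum_label0.
rewrite !(sum_label _ _ _ iS); apply: (eb_edge bze zab) => t t' _ _ ztt; rewrite (dAB _ _ _ ztt).
suff -> : [set l | tnth t l == tnth t i] = [set l | tnth t' l == tnth t' i] by [].
by apply/setP => l; rewrite !inE ztt.1.
Qed.

Lemma entry_multiset (ze : A -> B -> Prop) (D : eqType) (dA : A -> D) (dB : B -> D) R
    (t : (ar R).-tuple A) (t' : (ar R).-tuple B) :
  tuple_rel ze t t' -> (forall a b, ze a b -> dA a = dB b) ->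
  perm_eq [seq (label a (mkc A t), dA a) | a <- enum {: A} & a \in t]
          [seq (label b (mkc B t'), dB b) | b <- enum {: B} & b \in t'].
Proof.
move=> ztt dAB; apply/perm_map_sum => c; rewrite !big_filter !big_enum_cond.
rewrite (sum_mem_tuple t (fun a => (label a (mkc A t), dA a) == c : nat)).
rewrite (sum_mem_tuple t' (fun b => (label b (mkc B t'), dB b) == c : nat)).
apply: eq_big => [i|i _]; first by rewrite !inE; apply: eq_forallb => l; rewrite ztt.1.
rewrite (dAB _ _ (ztt.2 i)); suff -> : label (tnth t i) (mkc A t) = label (tnth t' i) (mkc B t') by [].
by congr (Tagged _ _); apply/setP => l; rewrite !inE ztt.1.
Qed.

Lemma elt_bisim_delta (ze : A -> B -> Prop) : elt_bisim ze -> forall j,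
  (forall a b, ze a b -> delta j (inl a : FV A) = delta j (inl b : FV B)) /\
  (forall R (t : (ar R).-tuple A) (t' : (ar R).-tuple B), tuple_rel ze t t' ->
     delta j (inr (mkc A t) : FV A) = delta j (inr (mkc B t') : FV B)).
Proof.
move=> bze; elim=> [|j [IHe IHc]]; first by [].
split=> [a b zab|R t t' ztt]; apply/eq_seq_msetP.
  exact: (edge_multiset (dA := fun c => delta j (inr c)) (dB := fun c => delta j (inr c)) bze zab IHc).
exact: (entry_multiset (dA := fun c => delta j (inl c)) (dB := fun c => delta j (inl c)) ztt IHe).
Qed.

Lemma delta_mem (C : struct s) (c : cons C) (T : eqType) (p : C -> T) (r : seq T) :
   perm_eq [seq p x | x <- enum {: C} & x \in tagged c] r -> exists x, p x \in r.
Proof.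
move=> e; exists (tnth (tagged c) (Ordinal (ar0 (tag c)))); rewrite -(perm_mem e).
by apply: map_f; rewrite mem_filter mem_enum andbT mem_tnth.
Qed.

(** A constraint has an entry, so equal colours would give an element and a constraint with equal
    colours one round earlier, and finally at round 0. *)
Lemma delta_kind j (C C' : struct s) (a : C) (c : cons C') :
  delta j.+1 (inl a : FV C) <> delta j.+1 (inr c : FV C').
Proof.
elim: j C C' a c => [|j IH] C C' a c /esym /eq_seq_msetP /delta_mem [x] /mapP [y _].
  by move/(congr1 snd).
by move/(congr1 snd); apply: IH.
Qed.

(** A colour does not contain its predecessor, so refinement is proved by induction through the
    neighbours; [delta_kind] starts it, as round 1 must still tell elements from constraints. *)
Lemma delta_mono j (v : FV A) (w : FV B) : isV v -> isV w ->
  delta j.+1 v = delta j.+1 w -> delta j v = delta j w.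
Proof.
have perm_le (T U C D : eqType) (p : T -> C) (q : U -> C) (p' : T -> D) (q' : U -> D) s1 s2 :
   (forall x y, x \in s1 -> y \in s2 -> p x = q y -> p' x = q' y) ->
   perm_eq (map p s1) (map q s2) -> perm_eq (map p' s1) (map q' s2).
  move=> pq e; apply: perm_map_sum => c; apply: (sum_match e) => x y xs ys exy.
  by rewrite (pq x y xs ys exy).
elim: j v w => [|j IH] [a|c] [b|c'] hv hw.
- by [].
- by move=> /delta_kind.
- by move=> /esym /delta_kind.
- by [].
- move=> /eq_seq_msetP e; apply/eq_seq_msetP; apply: perm_le e => x y.
  rewrite !mem_filter => /andP [/andP [xV _] _] /andP [/andP [yV _] _] e2.
  by congr (_, _); [exact: (congr1 fst e2)|apply: IH => //; exact: (congr1 snd e2)].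
- by move=> /delta_kind.
- by move=> /esym /delta_kind.
move=> /eq_seq_msetP e; apply/eq_seq_msetP; apply: perm_le e => x y _ _ e2.
by congr (_, _); [exact: (congr1 fst e2)|apply: IH => //; exact: (congr1 snd e2)].
Qed.

Definition delta_equiv (v : FV A) (w : FV B) := forall j, delta j v = delta j w.

(** Finitely many pairs are separated, each at some round; by [delta_mono] they stay separated, so
    one late round replaces the whole colour sequence. *)
Lemma delta_stable : exists J, forall v w, isV v -> isV w ->
  delta J v = delta J w -> delta_equiv v w.
Proof.
have /choice [J JP] : forall vw : FV A * FV B, exists j,
    delta j vw.1 = delta j vw.2 -> delta_equiv vw.1 vw.2.
  move=> [v w] /=; have [e|/existsNP [j ne]] := pselect (delta_equiv v w); first by exists 0.
  by exists j => /ne.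
exists (\max_vw J vw) => v w hv hw e; apply: (JP (v, w)) => /=.
have : J (v, w) <= \max_vw J vw by apply: leq_bigmax.
elim: (\max_vw J vw) e => [|m IH] e; first by rewrite leqn0 => /eqP ->.
rewrite leq_eqVlt => /orP [/eqP -> //|]; rewrite ltnS; apply: IH.
exact: delta_mono e.
Qed.

Lemma sum_Vert (C : struct s) (G : FV C -> nat) :
  \sum_(v : Vert C) G (val v) =
  \sum_a G (inl a) + \sum_(R : s) \sum_(t in rrel C R) G (inr (mkc C t)).
Proof.
rewrite sum_sig big_sumType /=; congr (_ + _).
have := sum_cons predT (fun c => G (inr c)); under eq_bigl do rewrite andbT.
move=> ->; apply: eq_bigr => R _; apply: eq_bigl => t; exact: andbT.
Qed.

Lemma elt_bisim_equiv1 (ze : A -> B -> Prop) : elt_bisim ze -> equiv1 A B.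
Proof.
move=> bze; have [J JP] := delta_stable; have dE := elt_bisim_delta bze.
have [c|f [fb fP]] := @matching_bij (Vert A) (Vert B) _
    (fun v => delta J (val v)) (fun v => delta J (val v)).
  rewrite (sum_Vert (fun v : FV A => delta J v == c : nat)) (sum_Vert (fun v : FV B => delta J v == c : nat)).
  congr (_ + _); first by apply: (eb_total bze) => a b /(dE J).1 ->.
  apply: eq_bigr => R _; pose i0 := Ordinal (ar0 R).
  (* Grouping the constraints by their first entry reduces their sum to [eb_edge] inside
     [eb_total]. *)
  rewrite (partition_big (fun t => tnth t i0) predT) //= [RHS](partition_big (fun t => tnth t i0) predT) //=.
  apply: (eb_total bze) => a b zab; apply: (eb_edge bze zab) => t t' _ _ /(dE J).2 -> //.
by exists f; split=> // j v; have /JP h := esym (fP v); rewrite h //; apply: valP.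
Qed.

(** The neighbour matched with entry [i] of [t] has a label containing [i], which forces it to be
    entry [i] of [t']; equality of the two labels gives the equality pattern. *)
Lemma cons_delta_rel J R (t : (ar R).-tuple A) (t' : (ar R).-tuple B) :
  (forall a b, delta J (inl a : FV A) = delta J (inl b : FV B) -> delta_equiv (inl a) (inl b)) ->
  delta J.+1 (inr (mkc A t) : FV A) = delta J.+1 (inr (mkc B t') : FV B) ->
  tuple_rel (fun a b => delta_equiv (inl a) (inl b)) t t'.
Proof.
move=> JP /eq_seq_msetP e.
have key i : (forall j, (tnth t j == tnth t i) = (tnth t' j == tnth t' i)) /\
    delta J (inl (tnth t i) : FV A) = delta J (inl (tnth t' i) : FV B).
  have : (label (tnth t i) (mkc A t), delta J (inl (tnth t i) : FV A)) \in
    [seq (label a (mkc A t), delta J (inl a : FV A)) | a <- enum {: A} & a \in t].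
    by apply: (map_f (fun a => (label a (mkc A t), delta J (inl a : FV A)))); rewrite mem_filter mem_enum mem_tnth.
  rewrite (perm_mem e) => /mapP [y _ ey0].
  have /eqP el := congr1 fst ey0; have ed := congr1 snd ey0.
  move: el; rewrite -/(label y (mkc B t')) eq_sym label_eq => /eqP /setP el.
  have ey : tnth t' i = y by have := el i; rewrite !inE eqxx => /eqP.
  by split=> [j|]; [have := el j; rewrite !inE ey|rewrite ey].
split=> [i j|i]; [exact: (key j).1|exact/JP/(key i).2].
Qed.

Lemma equiv1_elt_bisim : equiv1 A B ->
  elt_bisim (fun (a : A) (b : B) => delta_equiv (inl a) (inl b)).
Proof.
case=> f [fb fP]; have [J JP] := delta_stable; split; last first.
  move=> F H FH.
  have sE (C : struct s) (G : C -> nat) :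
    \sum_a G a = \sum_(v : Vert C) (if val v is inl a then G a else 0).
    rewrite (sum_Vert (fun v => if v is inl a then G a else 0)) /=.
    by rewrite [X in _ + X]big1 ?addn0 // => R _; rewrite big1.
  rewrite !sE [RHS](reindex f); last exact: onW_bij.
  apply: eq_bigr => v _; have := fP^~ v.
  by case: (val v) (val (f v)) => [a|c] [b|c'] h //; [apply: FH => j; exact: esym (h j)|have := h 0|have := h 0].
move=> a b zab R i F H FH.
(* Two rounds above [J] are used: one leads from the element to its constraints, one from these to
   their entries. *)
pose pA (c : cons A) := (label a c, delta J.+1 (inr c : FV A)).
pose pB (c : cons B) := (label b c, delta J.+1 (inr c : FV B)).
have e : perm_eq [seq pA c | c <- enum {: cons A} & isC c && (a \in tagged c)]
    [seq pB c | c <- enum {: cons B} & isC c && (b \in tagged c)].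
  by apply/eq_seq_msetP; exact: zab J.+2.
(* The sum over tuples of [R] is spread over all constraints around [c], each contributing at most
   one term, so that [sum_match] applies. *)
have FE (C : struct s) (c : C) (G : (ar R).-tuple C -> nat) :
  \sum_(u <- [seq u <- enum {: cons C} | isC u && (c \in tagged u)])
    \sum_(t : (ar R).-tuple C | (mkc C t == u) && (tnth t i == c)) G t =
  \sum_(t in rrel C R | tnth t i == c) G t.
  rewrite big_filter big_enum_cond (exchange_big_dep
    (fun t : (ar R).-tuple C => (t \in rrel C R) && (tnth t i == c))) /=.
    apply: eq_bigr => t /andP [tR ti]; rewrite (big_pred1 (mkc C t)) // => u /=.
    rewrite [_ == u]eq_sym ti andbT; case: eqP => [->|//]; rewrite ?andbF //.
    by rewrite /isC /= tR -(eqP ti) mem_tnth.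
  by move=> u t /andP [uC cu] /andP [/eqP eu ti]; rewrite ti andbT; move: uC; rewrite -eu.
rewrite -!FE; apply: (sum_match e) => c c'.
rewrite !mem_filter => /andP [/andP [cV _] _] /andP [/andP [cV' _] _] e0.
have el : label a c = label b c' := congr1 fst e0.
have ed : delta J.+1 (inr c : FV A) = delta J.+1 (inr c' : FV B) := congr1 snd e0.
have tE : tag c = tag c' := congr1 (@tag _ _) el.
clear e0 e pA pB.
case: c c' cV cV' el ed tE => [R1 t] [R2 t'] tV tV' /= el ed tE; case: _ / tE t' tV' el ed => t' tV' el ed.
have [eR|/eqP nR] := eqVneq R1 R; last first.
  have none (C : struct s) (u : (ar R1).-tuple C) (v : (ar R).-tuple C) : (mkc C v == mkc C u) = false.
    by apply/eqP => /(congr1 (@tag _ _)) /= e; apply: nR.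
  by rewrite !big_pred0 // => u; rewrite none.
clear FE; subst R1.
have ltE := cons_delta_rel _ ed.
have single (C : struct s) (c : C) (G : (ar R).-tuple C -> nat) (u : (ar R).-tuple C) :
  \sum_(t : (ar R).-tuple C | (mkc C t == mkc C u) && (tnth t i == c)) G t =
  if tnth u i == c then G u else 0.
  rewrite (eq_bigl (fun t => (t == u) && (tnth t i == c))) => [|v].
    by rewrite big_mkcondr (big_pred1 u).
  by rewrite -tag_eqE /tag_eq /= eqxx tagged_asE.
rewrite !single.
have -> : (tnth t i == a) = (tnth t' i == b).
  have /eqP := el; rewrite label_eq => /eqP /setP /(_ i); rewrite !inE //.
case: ifP => // _; apply: FH => //; apply: ltE => x y; exact: JP.
Qed.

End Equiv1.

(** * The structure of tuples and constraints *)

Lemma onth_tnth (T : Type) n (t : n.-tuple T) (i : 'I_n) : onth t i = Some (tnth t i).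
Proof.
have x := tnth t i.
by rewrite onthE (nth_map x) ?size_tuple // -tnth_nth.
Qed.

Lemma sum_tuple1 (T : finType) (P : pred T) (F : 1.-tuple T -> nat) (p : 'I_1) x :
  \sum_(u in [set u : 1.-tuple T | P (thead u)] | tnth u p == x) F u =
  if P x then F [tuple x] else 0.
Proof.
rewrite (eq_bigl (fun u => P x && (u == [tuple x]))) => [|u].
  by case: (P x); [rewrite (big_pred1 [tuple x])|rewrite big_pred0].
rewrite inE (ord1 p); apply/andP/andP => [[Pu /eqP ux]|[Px /eqP ->]] //.
rewrite -ux; split; first exact: Pu.
by apply/eqP/eq_from_tnth => i; rewrite (ord1 i).
Qed.

Lemma sum_tuple2 (T : finType) (Q : rel T) (F : 2.-tuple T -> nat) (p : 'I_2) x :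
  \sum_(u in [set u : 2.-tuple T | Q (tnth u ord0) (tnth u ord_max)] | tnth u p == x) F u =
  if p == ord0 then \sum_(y | Q x y) F [tuple x; y] else \sum_(y | Q y x) F [tuple y; x].
Proof.
have p01 (i : 'I_2) : i = if i == ord0 then ord0 else ord_max.
  by apply/val_inj; case: i => [[|[|]]].
have ext (u v : 2.-tuple T) : tnth u ord0 = tnth v ord0 -> tnth u ord_max = tnth v ord_max -> u = v.
  by move=> e0 e1; apply: eq_from_tnth => i; rewrite (p01 i); case: ifP.
have tE (y z : T) : (tnth [tuple y; z] ord0 = y) * (tnth [tuple y; z] ord_max = z) by [].
case: ifP => p0.
  rewrite (eqP p0) (reindex_onto (fun y => [tuple x; y]) (fun u => tnth u ord_max)) /=.
    by apply: eq_bigl => y; rewrite inE !tE (eqxx x) (eqxx y) !andbT.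
  by move=> u /andP [_ /eqP ux]; apply: ext; rewrite !tE ?ux.
have -> : p = ord_max by rewrite (p01 p) p0.
rewrite (reindex_onto (fun y => [tuple y; x]) (fun u => tnth u ord0)) /=.
  by apply: eq_bigl => y; rewrite inE !tE (eqxx x) (eqxx y) !andbT.
by move=> u /andP [_ /eqP ux]; apply: ext; rewrite !tE ?ux.
Qed.

(** * Elements and relations of A^{*k} *)

Section StarElements.
Variables (s : sign) (k : nat) (A : struct s).

Definition proj m n (i : m.-tuple 'I_n) (t : n.-tuple A) : m.-tuple A :=
  [tuple tnth t (tnth i l) | l < m].

Definition Xt (j : 'I_k) (t : (j.+1).-tuple A) : SU k A :=
  exist (fun x : SU0 k A => isSU x) (inl (Tagged (fun j : 'I_k => (j.+1).-tuple A) t)) isT.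
Definition Xc R (t : (ar R).-tuple A) (h : t \in rrel A R) : SU k A :=
  exist (fun x : SU0 k A => isSU x) (inr (Tagged (fun R : s => (ar R).-tuple A) t)) h.

Lemma SU_case (x : SU k A) :
  (exists j t, x = @Xt j t) \/ (exists R t h, x = @Xc R t h).
Proof.
case: x => [[[j t]|[R t]] h]; [left; exists j, t|right; exists R, t, h]; exact: val_inj.
Qed.

Lemma Xt_inj (j : 'I_k) : injective (@Xt j).
Proof.
by move=> t u /(congr1 val) [] /eqP; rewrite -tag_eqE /tag_eq /= eqxx tagged_asE => /eqP.
Qed.

Lemma Xt_eq (j : 'I_k) (t u : (j.+1).-tuple A) : (Xt t == Xt u) = (t == u).
Proof. exact: inj_eq (@Xt_inj j) t u. Qed.

Lemma Xt_tag (j j' : 'I_k) (t : (j.+1).-tuple A) (u : (j'.+1).-tuple A) : Xt t = Xt u -> j = j'.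
Proof. by move/(congr1 val) => /= [] e _. Qed.

(** Extension by 0 to constraints that do not hold, so that summands need no membership proof. *)
Definition oval (F : SU k A -> nat) (z : SU0 k A) : nat := oapp F 0 (insub z).

Lemma oval_val F (x : SU k A) : oval F (val x) = F x.
Proof. by rewrite /oval valK. Qed.

Lemma oval_Xc F R (t : (ar R).-tuple A) h :
  oval F (inr (Tagged (fun R : s => (ar R).-tuple A) t)) = F (@Xc R t h).
Proof. exact: (oval_val F (Xc h)). Qed.

Lemma sum_SU (F : SU k A -> nat) :
  \sum_x F x = \sum_(j : 'I_k) \sum_(t : (j.+1).-tuple A) F (Xt t) +
    \sum_(R : s) \sum_(t in rrel A R) oval F (inr (Tagged (fun R : s => (ar R).-tuple A) t)).
Proof.
under eq_bigr do rewrite -oval_val.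
rewrite (sum_sig (@isSU s k A) (oval F)) big_sumType /= sum_sigT /=; congr (_ + _).
  by apply: eq_bigr => j _; apply: eq_bigr => t _; rewrite -oval_val.
have := @sum_cons s A predT (fun c => oval F (inr c)).
under eq_bigl do rewrite andbT.
by move=> ->; apply: eq_bigr => R _; apply: eq_bigl => t; rewrite andbT.
Qed.

Lemma PT_Xt (j : 'I_k) (S : {set 'I_j.+1}) (t : (j.+1).-tuple A) :
  PT S (Xt t) = [forall i in S, forall i' in S, tnth t i == tnth t i'].
Proof.
rewrite /PT /= eqxx /=; apply: eq_forallb => i; congr (_ ==> _).
by apply: eq_forallb => i'; congr (_ ==> _); rewrite !onth_tnth.
Qed.

Lemma PT_neq (j j' : 'I_k) (S : {set 'I_j.+1}) (t : (j'.+1).-tuple A) : j' != j -> PT S (Xt t) = false.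
Proof. by rewrite /PT /= => /negbTE ->. Qed.

Lemma PR_Xc R (S : {set 'I_(ar R)}) (t : (ar R).-tuple A) h :
  PR S (@Xc R t h) = [forall i in S, forall i' in S, tnth t i == tnth t i'].
Proof.
rewrite /PR /= eqxx /=; apply: eq_forallb => i; congr (_ ==> _).
by apply: eq_forallb => i'; congr (_ ==> _); rewrite !onth_tnth.
Qed.

Lemma PR_neq R R' (S : {set 'I_(ar R)}) (t : (ar R').-tuple A) h : R' != R -> PR S (@Xc R' t h) = false.
Proof. by rewrite /PR /= => /negbTE ->. Qed.

Lemma proj_onth m n (i : m.-tuple 'I_n) (t : n.-tuple A) :
  [seq onth t l | l <- map val i] = map Some (proj i t).
Proof.
have -> : proj i t = map_tuple (tnth t) i by apply: eq_from_tnth => l; rewrite tnth_mktuple tnth_map.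
by rewrite -!map_comp; apply: eq_map => l /=; rewrite onth_tnth.
Qed.

Lemma proj_match m n (i : m.-tuple 'I_n) (t : n.-tuple A) q (u : q.-tuple A) :
  (map Some u == [seq onth t l | l <- map val i]) = (tval u == tval (proj i t)).
Proof. by rewrite proj_onth; apply: inj_eq; apply: inj_map => x y []. Qed.

(** [QT] and [QR] compare bare sequences; a sequence determines its length and hence the element. *)
Lemma Xt_tval (j j' : 'I_k) (u : (j.+1).-tuple A) (v : (j'.+1).-tuple A) :
  (tval u == tval v) = (Xt u == Xt v).
Proof.
apply/eqP/eqP => [e|]; last first.
  by move=> e; have ej := Xt_tag e; subst j'; rewrite (Xt_inj e).
have ej : j = j' by apply/val_inj/succn_inj; rewrite -(size_tuple u) -(size_tuple v) e.
by subst j'; congr (Xt _); apply: val_inj.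
Qed.

Lemma QT_Xt (j j' : 'I_k) (i : (j'.+1).-tuple 'I_j.+1) (t : (j.+1).-tuple A) y :
  QT i (Xt t) y = (y == Xt (proj i t)).
Proof.
have [[l [u ->]]|[R [u [h ->]]]] := SU_case y; last by [].
by rewrite /QT /= eqxx /= proj_match Xt_tval.
Qed.

Lemma QT_neq (j j' l : 'I_k) (i : (j'.+1).-tuple 'I_j.+1) (t : (l.+1).-tuple A) y :
  l != j -> QT i (Xt t) y = false.
Proof.
have [[l' [u ->]]|[R [u [h ->]]]] := SU_case y; last by [].
by rewrite /QT /= => /negbTE ->.
Qed.

Lemma QT_Xc (j j' : 'I_k) R (i : (j'.+1).-tuple 'I_j.+1) (t : (ar R).-tuple A) h y :
  QT i (@Xc R t h) y = false.
Proof. by []. Qed.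

Lemma QR_Xc (j : 'I_k) R (i : (j.+1).-tuple 'I_(ar R)) (t : (ar R).-tuple A) h y :
  QR i (@Xc R t h) y = (y == Xt (proj i t)).
Proof.
have [[l [u ->]]|[R' [u [h' ->]]]] := SU_case y; last by [].
by rewrite /QR /= eqxx /= proj_match Xt_tval.
Qed.

Lemma QR_neq (j : 'I_k) R R' (i : (j.+1).-tuple 'I_(ar R)) (t : (ar R').-tuple A) h y :
  R' != R -> QR i (@Xc R' t h) y = false.
Proof.
have [[l' [u ->]]|[R1 [u [h' ->]]]] := SU_case y; last by [].
by rewrite /QR /= => /negbTE ->.
Qed.

Lemma sum_QT (j j' : 'I_k) (i : (j'.+1).-tuple 'I_j.+1) y (F : SU k A -> nat) :
  \sum_(x | QT i x y) F x = \sum_(t : (j.+1).-tuple A | y == Xt (proj i t)) F (Xt t).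
Proof.
rewrite big_mkcond sum_SU [X in _ + X]big1 ?addn0 => [|R _]; last first.
  by apply: big1 => t h; rewrite -[inr _]/(val (Xc h)) oval_val QT_Xc.
rewrite (bigD1 j) //= [X in _ + X]big1 ?addn0 => [|l lj]; last first.
  by apply: big1 => t _; rewrite QT_neq.
by rewrite [RHS]big_mkcond; apply: eq_bigr => t _; rewrite QT_Xt.
Qed.

Lemma sum_QR (j : 'I_k) R (i : (j.+1).-tuple 'I_(ar R)) y (F : SU k A -> nat) :
  \sum_(x | QR i x y) F x =
  \sum_(t in rrel A R | y == Xt (proj i t)) oval F (inr (Tagged (fun R : s => (ar R).-tuple A) t)).
Proof.
rewrite big_mkcond sum_SU [X in X + _]big1 ?add0n => [|l _]; last by apply: big1.
rewrite (bigD1 R) //= [X in _ + X]big1 ?addn0 => [|R' nR]; last first.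
  by apply: big1 => t h; rewrite -[inr _]/(val (Xc h)) oval_val QR_neq.
rewrite [RHS]big_mkcondr; apply: eq_bigr => t h.
by rewrite -[inr _]/(val (Xc h)) !oval_val QR_Xc.
Qed.

End StarElements.

(** * Sums over tuples lying under pebbles *)

Section TupleSums.
Variables (s : sign) (k : nat) (A B : struct s).
Variables (Z : {ffun 'I_k -> A} -> {ffun 'I_k -> B} -> Prop) (bZ : pebble_bisim Z).
Hypothesis k0 : 0 < k.

Definition ptuple n (t : n.-tuple A) (t' : n.-tuple B) :=
  pebbled Z setT [ffun i => tnth t i] [ffun i => tnth t' i].

Lemma ptuple_eq n (t : n.-tuple A) (t' : n.-tuple B) : ptuple t t' ->
  forall i j, (tnth t i == tnth t j) = (tnth t' i == tnth t' j).
Proof. by move=> z i j; have := pebbled_eq bZ z (in_setT i) (in_setT j); rewrite !ffunE. Qed.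

Lemma ptuple_proj m n (i : m.-tuple 'I_n) t t' : ptuple t t' -> ptuple (proj i t) (proj i t').
Proof.
case=> p [a [b [zab e]]]; exists (fun l => p (tnth i l)), a, b; split=> // l _.
by rewrite !ffunE !tnth_mktuple; have := e (tnth i l) (in_setT _); rewrite !ffunE.
Qed.

Lemma ptuple_rel R (t : (ar R).-tuple A) (t' : (ar R).-tuple B) : ptuple t t' ->
  (t \in rrel A R) = (t' \in rrel B R).
Proof.
move=> z; have := pebbled_rel bZ (t := ord_tuple (ar R)) z (subsetT _).
have E (C : struct s) (u : (ar R).-tuple C) : map_tuple [ffun i => tnth u i] (ord_tuple (ar R)) = u.
  by apply: eq_from_tnth => i; rewrite tnth_map ffunE tnth_ord_tuple.
by rewrite !E.
Qed.

Lemma sum_tuple_ffun (C : struct s) n (P : pred (n.-tuple C)) (F : n.-tuple C -> nat) :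
  \sum_(t | P t) F t = \sum_(h : {ffun 'I_n -> C} | P [tuple h i | i < n]) F [tuple h i | i < n].
Proof.
rewrite (reindex (fun h : {ffun 'I_n -> C} => [tuple h i | i < n])) //.
exists (fun t : n.-tuple C => [ffun i => tnth t i]) => t _.
  by apply/ffunP => i; rewrite ffunE tnth_mktuple.
by apply: eq_from_tnth => i; rewrite tnth_mktuple ffunE.
Qed.

(** Since [n <= k], all entries fit under pebbles, and those outside [D] are summed by
    [pinvariant_sum]. *)
Lemma sum_ptuple_agree n (D : {set 'I_n}) h h' F H : n <= k -> pebbled Z D h h' ->
  (forall t t', ptuple t t' -> F t = H t') ->
  \sum_(t : n.-tuple A | [forall d in D, tnth t d == h d]) F t =
  \sum_(t : n.-tuple B | [forall d in D, tnth t d == h' d]) H t.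
Proof.
move=> nk z FH; rewrite !sum_tuple_ffun.
have := @pinvariant_sum _ _ _ _ _ bZ 'I_n setT (~: D) (fun h => F [tuple h i | i < n])
   (fun h => H [tuple h i | i < n]) (subsetT _).
rewrite cardsT card_ord setTD setCK => /(_ nk) h1.
have agE (C : struct s) (f g : {ffun 'I_n -> C}) :
    [forall d in D, tnth [tuple g i | i < n] d == f d] = agree (~: D) f g.
  by apply: eq_forallb => y; rewrite !inE negbK tnth_mktuple.
under eq_bigl => g do rewrite agE; under [RHS]eq_bigl => g do rewrite agE.
apply: h1 z => g g' zg; apply: FH; rewrite /ptuple.
have E (C : struct s) (f : {ffun 'I_n -> C}) : [ffun i => tnth [tuple f i | i < n] i] = f.
  by apply/ffunP => i; rewrite ffunE tnth_mktuple.
by rewrite !E.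
Qed.

Lemma sum_ptuple n F H : 0 < n <= k -> (forall t t', ptuple t t' -> F t = H t') ->
  \sum_(t : n.-tuple A) F t = \sum_(t : n.-tuple B) H t.
Proof.
case/andP=> n0 nk FH; have noT (C : struct s) (G : n.-tuple C -> nat) : #|C| = 0 -> \sum_t G t = 0.
  by move=> C0; apply: big1 => t _; have := fintype0 (tnth t (Ordinal n0)) C0.
have [A0|/card_gt0P [a _]] := posnP #|A|.
  by rewrite !noT // (pebble_equiv_empty (ex_intro _ Z bZ) k0).1.
have [b z] := pb_totl bZ [ffun => a].
have h := sum_ptuple_agree nk
  (pebbled0 z (Ordinal k0) ([ffun => a] : {ffun 'I_n -> A}) [ffun => b (Ordinal k0)]) FH.
transitivity (\sum_(t : n.-tuple A | [forall d in set0, tnth t d == [ffun => a] d]) F t).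
  by apply: eq_bigl => t; apply/esym/forall_inP => d; rewrite inE.
by rewrite h; apply: eq_bigl => t; apply/forall_inP => d; rewrite inE.
Qed.

(* The tuples with a given projection: those whose entries at the positions of
   [i] are prescribed, if the prescription is consistent. *)
Lemma sum_ptuple_proj m n (i : m.-tuple 'I_n) u u' F H : 0 < m -> n <= k -> ptuple u u' ->
  (forall t t', ptuple t t' -> F t = H t') ->
  \sum_(t : n.-tuple A | u == proj i t) F t = \sum_(t : n.-tuple B | u' == proj i t) H t.
Proof.
(* [sec] is a section of [i] over its image: the entry prescribed at [d] is the one at [sec d]. *)
move=> m0 nk zu FH; pose sec (d : 'I_n) : 'I_m := if [pick l | tnth i l == d] is Some l then l else Ordinal m0.
have secK l : tnth i (sec (tnth i l)) = tnth i l.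
  by rewrite /sec; case: pickP => [l' /eqP //|/(_ l)]; rewrite eqxx.
pose D := [set tnth i l | l : 'I_m].
pose cst (C : struct s) (v : m.-tuple C) := [forall l, tnth v l == tnth v (sec (tnth i l))].
have projE (C : struct s) (v : m.-tuple C) (t : n.-tuple C) :
   (v == proj i t) = cst C v && [forall d in D, tnth t d == [ffun d => tnth v (sec d)] d].
  apply/eqP/andP => [->|[/forallP vc /forall_inP tv]].
    split; first by apply/forallP => l; rewrite !tnth_mktuple secK.
    by apply/forall_inP => d /imsetP [l _ ->]; rewrite ffunE tnth_mktuple secK.
  apply: eq_from_tnth => l; rewrite tnth_mktuple (eqP (vc l)).
  by have := tv (tnth i l) (imset_f _ isT); rewrite ffunE => /eqP.
have cE : cst A u = cst B u' by apply: eq_forallb => l; apply: ptuple_eq.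
under eq_bigl => t do rewrite projE; under [RHS]eq_bigl => t do rewrite projE.
rewrite -cE; case: (cst A u); last by rewrite !big_pred0.
apply: sum_ptuple_agree => //; case: zu => p [a [b [zab e]]].
exists (fun d => p (sec d)), a, b; split=> // d _.
by have := e (sec d) (in_setT _); rewrite !ffunE.
Qed.

End TupleSums.

(** * From the pebble game to refinement of A^{*k} *)

Section StarBisim.
Variables (s : sign) (k : nat) (A B : struct s).
Variables (Z : {ffun 'I_k -> A} -> {ffun 'I_k -> B} -> Prop) (bZ : pebble_bisim Z).
Hypothesis k0 : 0 < k.
Hypothesis ar0 : forall R : s, 0 < ar R.
Hypothesis ark : forall R : s, ar R <= k.

Inductive star_zrel : SU k A -> SU k B -> Prop :=
| star_zrel_t (j : 'I_k) (t : (j.+1).-tuple A) (t' : (j.+1).-tuple B) :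
    ptuple Z t t' -> star_zrel (Xt t) (Xt t')
| star_zrel_c (R : s) (t : (ar R).-tuple A) (t' : (ar R).-tuple B) h h' :
    ptuple Z t t' -> star_zrel (@Xc s k A R t h) (@Xc s k B R t' h').

Lemma oval_zrel F H R (t : (ar R).-tuple A) (t' : (ar R).-tuple B) :
  ptuple Z t t' -> (forall h h', F (@Xc s k A R t h) = H (@Xc s k B R t' h')) ->
  (if t \in rrel A R then oval F (inr (Tagged (fun R : s => (ar R).-tuple A) t)) else 0) =
  (if t' \in rrel B R then oval H (inr (Tagged (fun R : s => (ar R).-tuple B) t')) else 0).
Proof.
move=> z FH; have := ptuple_rel bZ z; case: (boolP (t \in _)) => h /esym h' //; rewrite h' //.
by rewrite (oval_Xc F h) (oval_Xc H h').
Qed.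

Lemma star_zrel_total F H : (forall x y, star_zrel x y -> F x = H y) ->
  \sum_x F x = \sum_y H y.
Proof.
move=> FH; rewrite !sum_SU; congr (_ + _); [apply: eq_bigr => j _|apply: eq_bigr => R _].
  by apply: (sum_ptuple bZ k0) => [|t t' z]; [rewrite ltn_ord|apply: FH; constructor].
rewrite big_mkcond [RHS]big_mkcond; apply: (sum_ptuple bZ k0); first by rewrite ar0 ark.
by move=> t t' z; apply: oval_zrel => // h h'; apply: FH; constructor.
Qed.

Lemma star_zrel_PT (j : 'I_k) (S : {set 'I_j.+1}) x y : star_zrel x y -> PT S x = PT S y.
Proof.
case=> [l t t' z|//]; have [e|n] := eqVneq l j; last by rewrite !PT_neq.
subst l; rewrite !PT_Xt; apply: eq_forallb => a; congr (_ ==> _).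
by apply: eq_forallb => b; congr (_ ==> _); apply: (ptuple_eq bZ).
Qed.

Lemma star_zrel_PR R (S : {set 'I_(ar R)}) x y : star_zrel x y -> PR S x = PR S y.
Proof.
case=> [//|l t t' h h' z]; have [e|n] := eqVneq l R; last by rewrite !PR_neq.
subst l; rewrite !PR_Xc; apply: eq_forallb => a; congr (_ ==> _).
by apply: eq_forallb => b; congr (_ ==> _); apply: (ptuple_eq bZ).
Qed.

Lemma tuple1_rel (x : SU k A) (y : SU k B) : star_zrel x y ->
  tuple_rel (A := star k A) (B := star k B) star_zrel [tuple x] [tuple y].
Proof. by move=> z; split=> [i j|i]; rewrite ?(ord1 i) ?(ord1 j) ?eqxx. Qed.

Lemma tuple2_rel (x x' : SU k A) (y y' : SU k B) : star_zrel x y -> star_zrel x' y' ->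
  (x == x') = (y == y') ->
  tuple_rel (A := star k A) (B := star k B) star_zrel [tuple x; x'] [tuple y; y'].
Proof.
move=> z z' e.
have tE (T : Type) (u v : T) (i : 'I_2) : tnth [tuple u; v] i = if i == ord0 then u else v.
  by case: i => [[|[|]]].
split=> [i j|i]; rewrite !tE; do ?case: ifP => _ //; by rewrite ?eqxx // eq_sym e eq_sym.
Qed.

(** A tuple can be its own projection, and the edge label then records both positions of the binary
    constraint. The equality pattern decides when this happens. *)
Lemma Xt_proj_eq (j j' : 'I_k) (i : (j'.+1).-tuple 'I_j.+1) (t : (j.+1).-tuple A) (t' : (j.+1).-tuple B) :
  ptuple Z t t' -> (Xt t == Xt (proj i t)) = (Xt t' == Xt (proj i t')).
Proof.
move=> z; have [e|/eqP n] := eqVneq j j'; last by apply/eqP/eqP => /Xt_tag.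
subst j'; rewrite !Xt_eq.
have pE (C : struct s) (u : (j.+1).-tuple C) : (u == proj i u) = [forall l, tnth u l == tnth u (tnth i l)].
  apply/eqP/forallP => [e l|e]; first by rewrite {1}e tnth_mktuple.
  by apply: eq_from_tnth => l; rewrite tnth_mktuple; apply/eqP.
by rewrite !pE; apply: eq_forallb => l; apply: (ptuple_eq bZ).
Qed.

(** For a binary symbol, fixing the first entry leaves at most one constraint, projections being
    functions; fixing the second leaves a fibre, handled by [sum_ptuple_proj]. *)
Lemma star_bisim : elt_bisim (A := star k A) (B := star k B) star_zrel.
Proof.
split; last exact: star_zrel_total.
move=> x y zxy; case=> [[[q|q]|q]|q] /= p F H FH.
- etransitivity; first exact: (sum_tuple1 (PT (tagged q)) F p x).
  etransitivity; last exact/esym/(sum_tuple1 (PT (tagged q)) H p y).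
  rewrite (star_zrel_PT _ zxy); case e : (PT _ y) => //.
  by apply: FH (tuple1_rel zxy); rewrite inE // (star_zrel_PT _ zxy).
- etransitivity; first exact: (sum_tuple1 (PR (tagged q)) F p x).
  etransitivity; last exact/esym/(sum_tuple1 (PR (tagged q)) H p y).
  rewrite (star_zrel_PR _ zxy); case e : (PR _ y) => //.
  by apply: FH (tuple1_rel zxy); rewrite inE // (star_zrel_PR _ zxy).
- case: q p F H FH => -[j j'] /= i p F H FH.
  have FH' (t : (j.+1).-tuple A) (t' : (j.+1).-tuple B) : ptuple Z t t' ->
    F [tuple Xt t; Xt (proj i t)] = H [tuple Xt t'; Xt (proj i t')].
    move=> z; apply: FH; rewrite ?inE; first exact: (etrans (QT_Xt i t _) (eqxx _)).
      exact: (etrans (QT_Xt i t' _) (eqxx _)).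
    apply: tuple2_rel; [by constructor| |exact: Xt_proj_eq].
    by constructor; apply: ptuple_proj.
  etransitivity; first exact: (sum_tuple2 (QT i) F p x).
  etransitivity; last exact/esym/(sum_tuple2 (QT i) H p y).
  case: ifP => _.
    case: zxy => [l t t' z|R t t' h h' z]; last by rewrite !big_pred0.
    have [e|n] := eqVneq l j; last by rewrite !big_pred0 // => w; apply: QT_neq.
    subst l; rewrite (big_pred1 (Xt (proj i t))) => [|w]; last exact: QT_Xt.
    by rewrite (big_pred1 (Xt (proj i t'))) => [|w]; [exact: FH'|exact: QT_Xt].
  rewrite (sum_QT i x (fun w => F [tuple w; x])) (sum_QT i y (fun w => H [tuple w; y])).
  case: zxy => [l u u' z|R t t' h h' z]; last by rewrite !big_pred0.
  have [e|/eqP n] := eqVneq l j'; last first.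
    by rewrite !big_pred0 // => w; apply/eqP => /Xt_tag.
  subst l; under eq_bigl => t do rewrite Xt_eq; under [RHS]eq_bigl => t do rewrite Xt_eq.
  transitivity (\sum_(t : (j.+1).-tuple A | u == proj i t) F [tuple Xt t; Xt (proj i t)]).
    by apply: eq_bigr => t /eqP <-.
  transitivity (\sum_(t : (j.+1).-tuple B | u' == proj i t) H [tuple Xt t; Xt (proj i t)]).
    by apply: (sum_ptuple_proj bZ) => //; apply: ltn_ord.
  by apply: eq_bigr => t /eqP <-.
case: q p F H FH => R [j i] /= p F H FH.
have FH' (t : (ar R).-tuple A) (t' : (ar R).-tuple B) h h' : ptuple Z t t' ->
  F [tuple @Xc s k A R t h; Xt (proj i t)] = H [tuple @Xc s k B R t' h'; Xt (proj i t')].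
  move=> z; apply: FH; rewrite ?inE; first exact: (etrans (QR_Xc i h _) (eqxx _)).
    exact: (etrans (QR_Xc i h' _) (eqxx _)).
  by apply: tuple2_rel => //; constructor; [|apply: ptuple_proj].
etransitivity; first exact: (sum_tuple2 (QR i) F p x).
etransitivity; last exact/esym/(sum_tuple2 (QR i) H p y).
case: ifP => _.
  case: zxy => [l t t' z|R' t t' h h' z]; first by rewrite !big_pred0.
  have [e|n] := eqVneq R' R; last by rewrite !big_pred0 // => w; apply: QR_neq.
  subst R'; rewrite (big_pred1 (Xt (proj i t))) => [|w]; last exact: QR_Xc.
  by rewrite (big_pred1 (Xt (proj i t'))) => [|w]; [exact: FH'|exact: QR_Xc].
rewrite (sum_QR i x (fun w => F [tuple w; x])) (sum_QR i y (fun w => H [tuple w; y])).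
case: zxy => [l u u' z|R' t t' h h' z]; last by rewrite !big_pred0 // => t1; rewrite andbF.
have [e|/eqP n] := eqVneq l j; last first.
  by rewrite !big_pred0 // => w; apply/andP => -[_ /eqP /Xt_tag].
subst l; under eq_bigl => t do rewrite Xt_eq andbC; under [RHS]eq_bigl => t do rewrite Xt_eq andbC.
rewrite [LHS]big_mkcondr [RHS]big_mkcondr.
transitivity (\sum_(t : (ar R).-tuple A | u == proj i t) (if t \in rrel A R then
    oval (fun w => F [tuple w; Xt (proj i t)]) (inr (Tagged (fun R : s => (ar R).-tuple A) t)) else 0)).
  by apply: eq_bigr => t /eqP <-.
transitivity (\sum_(t : (ar R).-tuple B | u' == proj i t) (if t \in rrel B R then
    oval (fun w => H [tuple w; Xt (proj i t)]) (inr (Tagged (fun R : s => (ar R).-tuple B) t)) else 0)).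
  apply: (sum_ptuple_proj bZ) => // t t' zt.
  by apply: (oval_zrel (F := fun w => F [tuple w; _]) (H := fun w => H [tuple w; _])) => // h h'; apply: FH'.
by apply: eq_bigr => t /eqP <-.
Qed.

End StarBisim.

Section Partners.
Variables (s : sign) (A B : struct s) (ze : A -> B -> Prop).
Hypothesis bze : elt_bisim ze.

Lemma elt_bisim_sym : elt_bisim (fun b a => ze a b).
Proof.
split=> [b a z R i F H FH|F H FH]; last by apply/esym/(eb_total bze) => a b /FH.
apply/esym/(eb_edge bze z) => t t' tR tR' [e1 e2]; apply/esym/FH => //.
by split=> // l m; rewrite e1.
Qed.

(* The elements of [A] without a partner form an invariant set that is empty on the other side. *)
Lemma elt_bisim_partner a : exists b, ze a b.
Proof.
pose F a := nat_of_bool `[< ~ exists b, ze a b >].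
have /eqP : \sum_a F a = 0.
  rewrite (@eb_total _ _ _ _ bze F (fun _ => 0)) ?big1 // => x y zxy.
  by rewrite /F; case: asboolP => // no; case: no; exists y.
rewrite sum_nat_eq0 => /forallP /(_ a); rewrite /F /= eqb0 => /asboolPn.
exact: contrapT.
Qed.
End Partners.

(** * From refinement of A^{*k} to the pebble game, for k >= 2 *)

Section StarConverse.
Variables (s : sign) (k' : nat) (A B : struct s).
Let k := k'.+2.
Hypothesis ar0 : forall R : s, 0 < ar R.
Hypothesis ark : forall R : s, ar R <= k.
Variable ze : SU k A -> SU k B -> Prop.
Hypothesis bze : elt_bisim (A := star k A) (B := star k B) ze.

(** An index [j] encodes length [j.+1], so [ord_max] stands for length [k]. *)
Definition star_tuple (C : struct s) (a : {ffun 'I_k -> C}) : SU k C :=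
  @Xt s k C ord_max [tuple a i | i < k].

Definition zinv (F : SU k A -> nat) (H : SU k B -> nat) := forall x y, ze x y -> F x = H y.

(** The number of constraints of this unary symbol at [x] is 1 or 0 according to whether [x]
    satisfies it. *)
Lemma zinv_PT (j : 'I_k) (S : {set 'I_j.+1}) x y : ze x y -> PT S x = PT S y.
Proof.
move=> z; pose q : starsig s k := inl (inl (inl (Tagged (fun j : 'I_k => {set 'I_j.+1}) S))).
have := @eb_edge _ _ _ _ bze _ _ z q (ord0 : 'I_1) (fun _ => 1) (fun _ => 1) (fun _ _ _ _ _ => erefl).
have e1 := sum_tuple1 (PT S) (fun _ => 1) ord0 x; have e2 := sum_tuple1 (PT S) (fun _ => 1) ord0 y.
move=> e; have {e} := etrans (etrans (esym e1) e) e2.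
by case: (PT S x); case: (PT S y).
Qed.

Lemma tuple_rel2 (t : 2.-tuple (SU k A)) (t' : 2.-tuple (SU k B)) F H : zinv F H ->
  tuple_rel (A := star k A) (B := star k B) ze t t' -> forall i, F (tnth t i) = H (tnth t' i).
Proof. by move=> FH [_ e] i; apply: FH. Qed.

Lemma zinv_QT_in (j j' : 'I_k) (i : (j'.+1).-tuple 'I_j.+1) F H : zinv F H ->
  zinv (fun y => \sum_(x | QT i x y) F x) (fun y => \sum_(x | QT i x y) H x).
Proof.
move=> FH x y z.
pose q : starsig s k := inl (inr (Tagged (fun jj : 'I_k * 'I_k => (jj.2.+1).-tuple 'I_(jj.1.+1))
  (i : ((j, j').2.+1).-tuple 'I_((j, j').1.+1)))).
have e := @eb_edge _ _ _ _ bze _ _ z q (ord_max : 'I_2) (fun t => F (tnth t ord0)) (fun t => H (tnth t ord0))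
  (fun t t' _ _ h => tuple_rel2 FH h ord0).
have e1 := sum_tuple2 (QT i) (fun t => F (tnth t ord0)) ord_max x.
have e2 := sum_tuple2 (QT i) (fun t => H (tnth t ord0)) ord_max y.
exact: (etrans (etrans (esym e1) e) e2).
Qed.

Lemma zinv_QT_out (j j' : 'I_k) (i : (j'.+1).-tuple 'I_j.+1) F H : zinv F H ->
  zinv (fun x => \sum_(y | QT i x y) F y) (fun x => \sum_(y | QT i x y) H y).
Proof.
move=> FH x y z.
pose q : starsig s k := inl (inr (Tagged (fun jj : 'I_k * 'I_k => (jj.2.+1).-tuple 'I_(jj.1.+1))
  (i : ((j, j').2.+1).-tuple 'I_((j, j').1.+1)))).
have e := @eb_edge _ _ _ _ bze _ _ z q (ord0 : 'I_2) (fun t => F (tnth t ord_max)) (fun t => H (tnth t ord_max))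
  (fun t t' _ _ h => tuple_rel2 FH h ord_max).
have e1 := sum_tuple2 (QT i) (fun t => F (tnth t ord_max)) ord0 x.
have e2 := sum_tuple2 (QT i) (fun t => H (tnth t ord_max)) ord0 y.
exact: (etrans (etrans (esym e1) e) e2).
Qed.

Lemma zinv_QR_in R (j : 'I_k) (i : (j.+1).-tuple 'I_(ar R)) F H : zinv F H ->
  zinv (fun y => \sum_(x | QR i x y) F x) (fun y => \sum_(x | QR i x y) H x).
Proof.
move=> FH x y z.
pose q : starsig s k := inr (Tagged (fun R : s => {j : 'I_k & (j.+1).-tuple 'I_(ar R)})
  (Tagged (fun j : 'I_k => (j.+1).-tuple 'I_(ar R)) i)).
have e := @eb_edge _ _ _ _ bze _ _ z q (ord_max : 'I_2) (fun t => F (tnth t ord0)) (fun t => H (tnth t ord0))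
  (fun t t' _ _ h => tuple_rel2 FH h ord0).
have e1 := sum_tuple2 (QR i) (fun t => F (tnth t ord0)) ord_max x.
have e2 := sum_tuple2 (QR i) (fun t => H (tnth t ord0)) ord_max y.
exact: (etrans (etrans (esym e1) e) e2).
Qed.

Lemma zinv_proj (j : 'I_k) (i : (j.+1).-tuple 'I_k) F H a b : zinv F H -> ze (star_tuple a) (star_tuple b) ->
  F (Xt (proj i [tuple a l | l < k])) = H (Xt (proj i [tuple b l | l < k])).
Proof.
move=> FH z; have := zinv_QT_out (j := ord_max) i FH z.
rewrite (big_pred1 (Xt (proj i [tuple a l | l < k]))) => [|w]; last exact: QT_Xt.
by rewrite (big_pred1 (Xt (proj i [tuple b l | l < k]))) => [|w]; last exact: QT_Xt.
Qed.

(** Extension by 0 of a function of k-tuples to the whole universe. *)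
Definition on_tup (C : struct s) (F : {ffun 'I_k -> C} -> nat) (x : SU k C) :=
  \sum_(a | x == star_tuple a) F a.

Lemma tup_inj (C : struct s) : injective (@star_tuple C).
Proof.
move=> a b /Xt_inj e; apply/ffunP => i.
by have := congr1 (fun t => tnth t i) e; rewrite !tnth_mktuple.
Qed.

Lemma on_tup_tup (C : struct s) (F : {ffun 'I_k -> C} -> nat) a : on_tup F (star_tuple a) = F a.
Proof. by rewrite /on_tup (big_pred1 a) // => b; rewrite (inj_eq (@tup_inj C)) eq_sym. Qed.

(** With [S] empty there is no equation to test, so the symbol recognises exactly the k-tuples. *)
Lemma PT_tup (C : struct s) (x : SU k C) :
  reflect (exists a, x = star_tuple a) (PT (set0 : {set 'I_(ord_max : 'I_k).+1}) x).
Proof.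
apply: (iffP idP) => [|[a ->]]; last by rewrite PT_Xt; apply/forall_inP => i; rewrite inE.
have [[j [t ->]]|[R [t [h ->]]]] := SU_case x; last by [].
have [e _|n] := eqVneq j ord_max; last by rewrite PT_neq.
subst j; exists [ffun i => tnth t i]; congr (Xt _).
by apply: eq_from_tnth => i; rewrite tnth_mktuple ffunE.
Qed.

Lemma zinv_on_tup F H : (forall a b, ze (star_tuple a) (star_tuple b) -> F a = H b) ->
  zinv (on_tup F) (on_tup H).
Proof.
move=> FH x y z; have e := zinv_PT (set0 : {set 'I_(ord_max : 'I_k).+1}) z.
have [px|px] := boolP (PT (set0 : {set 'I_(ord_max : 'I_k).+1}) x).
  have [a xa] := PT_tup x px; have [b yb] : exists b, y = star_tuple b by apply/PT_tup; rewrite -e.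
  by rewrite xa yb !on_tup_tup; apply: FH; rewrite -xa -yb.
have npred (C : struct s) (w : SU k C) :
    ~~ PT (set0 : {set 'I_(ord_max : 'I_k).+1}) w -> (fun a => w == star_tuple a) =1 xpred0.
  by move=> pw a; apply/negP => /eqP wa; case/PT_tup: pw; exists a.
by rewrite /on_tup !big_pred0 //; apply: npred; rewrite -?e.
Qed.

Lemma star_pebble_bisim : pebble_bisim (fun a b => ze (star_tuple a) (star_tuple b)).
Proof.
split.
- move=> a b z i j; have := zinv_PT (j := ord_max) [set i; j] z; rewrite !PT_Xt.
  have E (C : struct s) (c : {ffun 'I_k -> C}) :
    [forall l in [set i; j], forall m in [set i; j],
      tnth [tuple c l | l < k] l == tnth [tuple c l | l < k] m] = (c i == c j).
    apply/forall_inP/eqP => [h|e l].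
      have /forall_inP := h i (set21 i j) => /(_ j (set22 i j)).
      by rewrite !tnth_mktuple => /eqP.
    move=> lS; apply/forall_inP => m mS; move: lS mS; rewrite !tnth_mktuple !inE.
    by case/orP => /eqP -> /orP [] /eqP ->; rewrite ?e.
  by rewrite (E A a) (E B b).
- move=> a b z R t.
  have jk : (ar R).-1 < k by rewrite prednK.
  pose j : 'I_k := Ordinal jk.
  have je : j.+1 = ar R by rewrite /= prednK.
  (* [i1] sends a constraint to the tuple of its entries, [i2] extracts from [a] the entries named
     by [t]. The relation holds at these exactly when this projection of [a] comes from a constraint
     of [R] under [i1]. *)
  pose i1 : (j.+1).-tuple 'I_(ar R) := [tuple cast_ord je l | l < j.+1].
  pose i2 : (j.+1).-tuple 'I_k := [tuple tnth t (cast_ord je l) | l < j.+1].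
  have inv1 : zinv (fun y => \sum_(x | QR i1 x y) 1) (fun y => \sum_(x | QR i1 x y) 1).
    exact: (zinv_QR_in i1 (F := fun _ => 1) (H := fun _ => 1)).
  have := zinv_proj i2 inv1 z.
  have E (C : struct s) (c : {ffun 'I_k -> C}) :
    \sum_(x | QR i1 x (Xt (proj i2 [tuple c l | l < k]))) 1 = (map_tuple c t \in rrel C R) :> nat.
    rewrite (sum_QR i1 _ (fun _ => 1)).
    rewrite (eq_bigl (fun u => (u \in rrel C R) && (u == map_tuple c t))) => [|u]; last first.
      congr (_ && _); rewrite Xt_eq; apply/eqP/eqP => [e|->].
        apply: eq_from_tnth => l; have := congr1 (fun u => tnth u (cast_ord (esym je) l)) e.
        by rewrite !tnth_mktuple cast_ordKV tnth_map => ->.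
      by apply: eq_from_tnth => l; rewrite !tnth_mktuple tnth_map.
    have [cR|cR] := boolP (map_tuple c t \in rrel C R).
      rewrite (big_pred1 (map_tuple c t)) => [|u]; first by rewrite (oval_Xc _ cR).
      by rewrite /=; case: eqP => [->|_]; rewrite ?cR ?andbF.
    by rewrite big_pred0 // => u; case: eqP => [->|_]; rewrite ?(negbTE cR) ?andbF.
  rewrite (E A a) (E B b); by do 2 case: (_ \in _).
- move=> a b z i F H FH.
  have jk : k' < k by rewrite /k ltnS leqnSn.
  pose j : 'I_k := Ordinal jk.
  (* [p] forgets the entry [i]; the remaining length [k - 1] is positive because [k >= 2]. *)
  pose p : (j.+1).-tuple 'I_k := [tuple lift i l | l < k'.+1].
  have inv1 := zinv_QT_in (j := ord_max) p (zinv_on_tup FH).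
  have := zinv_proj p inv1 z.
  have E (C : struct s) (c : {ffun 'I_k -> C}) (G : {ffun 'I_k -> C} -> nat) :
    \sum_(x | QT (j := ord_max) p x (Xt (proj p [tuple c l | l < k]))) on_tup G x = \sum_d G (upd c i d).
    rewrite (sum_QT (j := ord_max) p _ (on_tup G)).
    rewrite (reindex (fun d : C => [tuple upd c i d l | l < k])) /=; last first.
      exists (fun t : k.-tuple C => tnth t i) => [d _|t]; first by rewrite tnth_mktuple ffunE eqxx.
      rewrite inE Xt_eq => /eqP e; apply: eq_from_tnth => l; rewrite tnth_mktuple ffunE.
      case: (unliftP i l) => [m ->|->]; last by rewrite eqxx.
      rewrite eq_sym (negbTE (neq_lift _ _)).
      by have := congr1 (fun u => tnth u m) e; rewrite !tnth_mktuple.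
    rewrite big_mkcond; apply: eq_bigr => d _; rewrite -/(star_tuple _) on_tup_tup Xt_eq.
    suff -> : proj p [tuple c l | l < k] == proj p [tuple upd c i d l | l < k] by [].
    apply/eqP/eq_from_tnth => l; rewrite !tnth_mktuple ffunE.
    by rewrite eq_sym (negbTE (neq_lift _ _)).
  by rewrite (E A a) (E B b).
- move=> a; have [y z] := elt_bisim_partner bze (star_tuple a).
  have /PT_tup [b yb] : PT (set0 : {set 'I_(ord_max : 'I_k).+1}) y.
    by rewrite -(zinv_PT _ z); apply/PT_tup; exists a.
  by exists b; rewrite -yb.
move=> b; have [x z] := elt_bisim_partner (elt_bisim_sym bze) (star_tuple b).
have /PT_tup [a xa] : PT (set0 : {set 'I_(ord_max : 'I_k).+1}) x.
  by rewrite (zinv_PT _ z); apply/PT_tup; exists b.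
by exists a; rewrite -xa.
Qed.

End StarConverse.

(** * The case of one pebble *)

Section Unary.
Variables (s : sign) (A B : struct s).
Hypothesis ar0 : forall R : s, 0 < ar R.
Hypothesis ar1 : forall R : s, ar R <= 1.

Lemma unary_pos (R : s) (i j : 'I_(ar R)) : i = j.
Proof. by apply: val_inj; have := ar1 R; have := ltn_ord i; have := ltn_ord j => /=; lia. Qed.

Lemma sum_unary (C : struct s) (R : s) (i : 'I_(ar R)) (c : C) (F : (ar R).-tuple C -> nat) :
  \sum_(t in rrel C R | tnth t i == c) F t =
  if [tuple c | _ < ar R] \in rrel C R then F [tuple c | _ < ar R] else 0.
Proof.
rewrite (eq_bigl (fun t => ([tuple c | _ < ar R] \in rrel C R) && (t == [tuple c | _ < ar R]))) => [|t].
  by case: ifP => _; [rewrite (big_pred1 [tuple c | _ < ar R])|rewrite big_pred0].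
have -> : (tnth t i == c) = (t == [tuple c | _ < ar R]).
  apply/eqP/eqP => [tc|->]; last by rewrite tnth_mktuple.
  by apply: eq_from_tnth => j; rewrite (unary_pos j i) tnth_mktuple.
by case: eqP => [->|]; rewrite ?andbT ?andbF.
Qed.

Lemma map_unary (C : struct s) (R : s) (a : {ffun 'I_1 -> C}) (t : (ar R).-tuple 'I_1) :
  map_tuple a t = [tuple a ord0 | _ < ar R].
Proof. by apply: eq_from_tnth => i; rewrite tnth_map tnth_mktuple; congr (a _); apply: ord1. Qed.

Lemma unary_const (C : struct s) (a : {ffun 'I_1 -> C}) c : upd a ord0 c = [ffun => c].
Proof. by apply/ffunP => i; rewrite !ffunE ord1. Qed.

(** A placement of one pebble is an element, and an element lies in at most one constraint of each
    symbol; so [eb_edge] reduces to [pb_rel]. Moving the pebble forgets everything, so [eb_total] is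
    [pb_sum]. *)
Lemma unary_elt_bisim (Z : {ffun 'I_1 -> A} -> {ffun 'I_1 -> B} -> Prop) :
  pebble_bisim Z -> elt_bisim (fun a b => Z [ffun => a] [ffun => b]).
Proof.
move=> bZ; have relE a b : Z [ffun => a] [ffun => b] -> forall R : s,
    ([tuple a | _ < ar R] \in rrel A R) = ([tuple b | _ < ar R] \in rrel B R).
  move=> z R; have := pb_rel bZ z [tuple ord0 | _ < ar R].
  by rewrite !map_unary !ffunE.
split=> [a b z R i F H FH|F H FH].
  rewrite !sum_unary (relE _ _ z); case: ifP => // bR; apply: FH => //; first by rewrite (relE _ _ z).
  by split=> [l m|l]; rewrite !tnth_mktuple ?eqxx.
have [A0|/card_gt0P [a _]] := posnP #|A|.
  have B0 := (pebble_equiv_empty (ex_intro _ Z bZ) (ltnSn 0)).1 A0.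
  by rewrite !big1 // => c _; [have := fintype0 c B0|have := fintype0 c A0].
have [b z] := pb_totl bZ [ffun => a].
have h := @pb_sum _ _ _ _ _ bZ _ _ z ord0 (fun a => F (a ord0)) (fun b => H (b ord0)).
transitivity (\sum_c F (upd ([ffun => a] : {ffun 'I_1 -> A}) ord0 c ord0)).
  by apply: eq_bigr => c _; rewrite ffunE eqxx.
rewrite h; first by apply: eq_bigr => c _; rewrite ffunE eqxx.
move=> u v zuv; apply: FH; move: zuv; congr (Z _ _); apply/ffunP => i; rewrite ffunE; congr (_ _); exact: ord1.
Qed.

Lemma unary_pebble_bisim (ze : A -> B -> Prop) : elt_bisim ze ->
  pebble_bisim (k := 1) (fun a b => ze (a ord0) (b ord0)).
Proof.
move=> bze; split.
- by move=> a b z i j; rewrite (ord1 i) (ord1 j) !eqxx.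
- move=> a b z R t; rewrite !map_unary.
  have := @eb_edge _ _ _ _ bze _ _ z R (Ordinal (ar0 R)) (fun _ => 1) (fun _ => 1) (fun _ _ _ _ _ => erefl).
  by rewrite !sum_unary; do 2 case: (_ \in _).
- move=> a b z i F H FH; rewrite (ord1 i).
  transitivity (\sum_c F [ffun => c]); first by apply: eq_bigr => c _; rewrite unary_const.
  transitivity (\sum_c H [ffun => c]); last by apply: eq_bigr => c _; rewrite unary_const.
  by apply: (eb_total bze) => c d zcd; apply: FH; rewrite !ffunE.
- by move=> a; have [b z] := elt_bisim_partner bze (a ord0); exists [ffun => b]; rewrite ffunE.
by move=> b; have [a z] := elt_bisim_partner (elt_bisim_sym bze) (b ord0); exists [ffun => a]; rewrite ffunE.
Qed.
End Unary.

Lemma equivk_pebble_equiv (s : sign) (k : nat) (A B : struct s) :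
  (forall R : s, 0 < ar R) -> 0 < k -> (forall R : s, ar R <= k) ->
  equivk k A B <-> pebble_equiv k A B.
Proof.
move=> ar0 + ark; rewrite /equivk; case: k ark => [//|[|k]] ark _ /=.
  split=> [/(equiv1_elt_bisim ar0) bze|[Z bZ]].
    by eexists; apply: unary_pebble_bisim bze.
  exact: elt_bisim_equiv1 (unary_elt_bisim ark bZ).
have star0 (q : starsig s k.+2) : 0 < ar q by case: q => [[[]|]|].
split=> [/(equiv1_elt_bisim star0) bze|[Z bZ]].
  by eexists; apply: star_pebble_bisim bze.
by apply: (elt_bisim_equiv1 star0); apply: star_bisim bZ _ ar0 ark.
Qed.

Theorem theorem7p6 (s : sign) (k : nat) :
  (forall R : s, 0 < ar R)%N ->
  (0 < k)%N ->
  (maxar s <= k)%N ->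
  forall A B : struct s,
    (equivk k A B <->
       (forall X : struct s, treewidth_lt X k -> homcount X A = homcount X B)) /\
    (equivk k A B <-> Ck_equiv k A B).
Proof.
move=> ar0 k0 /bigmax_leqP ark A B.
have e := @equivk_pebble_equiv s k A B ar0 k0 (fun R => ark R isT).
split; split.
- by move=> /e; apply: pebble_equiv_hom.
- by move=> h; apply/e/hom_pebble_equiv.
- by move=> /e; apply: pebble_equiv_Ck.
by move=> h; apply/e/Ck_pebble_equiv.
Qed.
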